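(* Let $X$ be a real Banach space and $C$ a nonempty closed convex bounded subset of $X$. Then the following assertions are equivalent. (1) Each nonempty closed convex subset of $C$ has the weak approximate fixed point property. (2) $C$ contains no sequence equivalent to the standard basis of $\ell_1$.
   Context: A nonempty closed convex bounded subset $D$ of a real Banach space is said to have the weak approximate fixed point property if for every (norm-)continuous mapping $f:D\to D$ there is a sequence $\{x_n\}$ in $D$ such that the sequence $\{x_n-f(x_n)\}$ weakly converges to $0$. A bounded sequence $\{x_n\}$ in a Banach space is equivalent to the standard basis of $\ell_1$ if there is a constant $c>0$ such that for any $N\in\mathbb{N}$ and any choice of $a_1,\dots,a_N\in\mathbb{R}$ we have $\left\|\sum_{n=1}^N a_n x_n\right\|\ge c\sum_{n=1}^N |a_n|$. Here ''closed'' and ''bounded'' refer to the norm. *)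

(* Defs.v *)
From HB Require Import structures.
From mathcomp Require Import all_boot all_order all_algebra.
From mathcomp Require Import all_classical all_reals all_analysis.

Set Implicit Arguments.
Unset Strict Implicit.
Unset Printing Implicit Defensive.

Import Order.TTheory GRing.Theory Num.Theory.
Import numFieldNormedType.Exports.

Local Open Scope classical_set_scope.
Local Open Scope ring_scope.

Definition weakly_converges (R : realType) (X : normedModType R)
    (u : nat -> X) (l : X) : Prop :=
  forall phi : {linear X -> R^o}, continuous phi ->
    phi (u n) @[n --> \oo] --> phi l.

(* A map D -> D is represented by a total function on X stabilizing D; only
   its restriction to D matters. *)
Definition weak_afpp (R : realType) (X : normedModType R) (D : set X) : Prop :=
  forall f : X -> X, set_fun D D f -> {within D, continuous f} ->
    exists2 x : nat -> X, (forall n, D (x n)) &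
      weakly_converges (fun n => x n - f (x n)) 0.

(* The upper l1-estimate is the boundedness of the sequence. *)
Definition equivalent_l1_basis (R : realType) (X : normedModType R)
    (x : nat -> X) : Prop :=
  bounded_fun x /\
  exists2 c : R, 0 < c &
    forall (N : nat) (a : 'I_N -> R),
      c * \sum_(n < N) `|a n| <= `| \sum_(n < N) a n *: x n |.

(* Main.v *)
Require Import Defs.
From HB Require Import structures.
From mathcomp Require Import all_boot all_order all_algebra.
From mathcomp Require Import ring lra zify.
Import Order.TTheory GRing.Theory Num.Theory.

(** (2) implies (1). Given a continuous self-map f of D, take a countable set
    E in D closed under f and rational convex combinations. For finitely many
    functionals, E contains points x at which all of them almost vanish on
    x - f x: this is Scarf's combinatorial proof of Brouwer's theorem, run on
    rational simplices spanned by finite nets of E. Hence some ultrafilter U on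
    E makes x - f x weakly null. A Ramsey argument with U replaces the theorems
    of Rosenthal and Bourgain-Fremlin-Talagrand: for levels a < b, either one
    can build inductively a sequence along which the conditions phi <= a and
    phi >= b are independent, so that it spans l1, or the obstruction is a
    well-founded tree of U-large sets, of which there are countably many, and
    phi converges to its U-limit along any sequence eventually in all of them.

    (1) implies (2). On the closed convex hull of an l1-sequence, let T_n be
    the mass carried by the indices >= n. The map which turns the tail sequence
    (T_n) into (1, g(T_0), g(T_1), ...), where g is 1 near 1 and 0 near 0, is
    continuous. If u_k - f(u_k) were weakly null, then T_n(u_k) would tend to 1
    for each n, so the mass of the u_k escapes to infinity, and a gliding hump
    gives a functional which does not vanish on u_k - f(u_k) in the limit. *)

Set Implicit Arguments.
Unset Strict Implicit.
Unset Printing Implicit Defensive.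

(** * Scarf's lemma *)

Lemma subset_cardS (T : finType) (A B : {set T}) :
  A \subset B -> #|A|.+1%N = #|B| -> exists x, x \notin A /\ B = x |: A.
Proof.
move=> AB cardAB; have : #|B :\: A| == 1%N.
  by rewrite cardsD (setIidPr AB) -cardAB subSnn.
move=> /cards1P[x Bx]; exists x.
have : x \in B :\: A by rewrite Bx set11.
rewrite inE => /andP[xA xB]; split=> //.
by rewrite -Bx setUC setDE setUIr setUCr setIT; apply/esym/setUidPr.
Qed.

Section scarf.
Local Open Scope nat_scope.
Variables (U I : finType) (r : I -> U -> nat).
Hypothesis r_inj : forall i, injective (r i).

(** Scarf's primitive sets: no point lies, in every order, strictly above some element of [B]. *)
Definition dominant (B : {set U}) :=
  [forall u, exists i, forall b in B, r i u <= r i b].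

Lemma dominantP (B : {set U}) :
  reflect (forall u, exists i, forall b, b \in B -> r i u <= r i b) (dominant B).
Proof.
apply: (iffP forallP) => H u; have := H u.
  by move=> /existsP[i /forall_inP Hi]; exists i.
by move=> [i Hi]; apply/existsP; exists i; apply/forall_inP.
Qed.

Lemma dominantS (A B : {set U}) : A \subset B -> dominant B -> dominant A.
Proof.
move=> AB /dominantP H; apply/dominantP => u; have [i Hi] := H u.
by exists i => b bA; apply: Hi; apply: (subsetP AB).
Qed.

Lemma dominant_min (B : {set U}) b0 : b0 \in B -> exists mu : I -> U,
  (forall i, mu i \in B) /\ (forall i b, b \in B -> r i (mu i) <= r i b).
Proof.
move=> b0B; exists (fun i => [arg min_(b < b0 in B) r i b]).
by split=> i; case: arg_minnP.
Qed.

Lemma dominant_min_surj (B : {set U}) (mu : I -> U) : dominant B ->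
  (forall i, mu i \in B) -> (forall i b, b \in B -> r i (mu i) <= r i b) ->
  mu @: setT = B.
Proof.
move=> /dominantP domB muB mumin; apply/setP => b.
apply/imsetP/idP => [[i _ ->]|bB]; first exact: muB.
have [i Hi] := domB b; exists i => //; apply: (@r_inj i); apply/eqP.
by rewrite eqn_leq mumin // Hi.
Qed.

(* The minima of [D] for the various orders exhaust [D], so exactly two orders
   [i] and [j] share their minimum. For each [e] of these two, one extension
   adds the [r e]-largest point lying above the minima for all orders but [e].
   *)
Lemma dominant_extensions (D : {set U}) : dominant D -> D != set0 ->
  #|D|.+1 = #|I| ->
  (forall i, exists u, forall k, k != i -> exists2 b, b \in D & r k b < r k u) ->
  #|[set B : {set U} | [&& D \subset B, dominant B & #|B| == #|I|]]| = 2.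
Proof.
move=> domD /set0Pn[b0 b0D] cardD above.
have [mu [muD mumin]] := dominant_min b0D.
have mu_surj := dominant_min_surj domD muD mumin.
have [i [j [ij muij]]] : exists i j, i != j /\ mu i = mu j.
  have : ~~ injectiveb mu.
    apply/negP => /injectiveP mu_inj; have := card_imset setT mu_inj.
    by rewrite mu_surj cardsT -cardD => /n_Sn.
  by move=> /injectivePn[i [j ij muij]]; exists i, j.
pose M e := [set u | [forall k, (k != e) ==> (r k (mu k) < r k u)]].
have MP e u k : u \in M e -> k != e -> r k (mu k) < r k u.
  by rewrite inE => /forallP/(_ k)/implyP.
have topM e : exists2 u, u \in M e & forall v, v \in M e -> r e v <= r e u.
  have [u Hu] := above e.
  have uM : u \in M e.
    rewrite inE; apply/forallP => k; apply/implyP => /Hu[b bD].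
    by apply: leq_ltn_trans; apply: mumin.
  by exists [arg max_(v > u in M e) r e v]; case: arg_maxnP.
have max_notin e e' u : e != e' -> mu e = mu e' -> u \in M e -> u \notin D.
  move=> ee' muee' uM; apply/negP; rewrite -mu_surj => /imsetP[l _ ul].
  have [le|le] := eqVneq l e.
    have := MP _ _ e' uM; rewrite eq_sym ee' => /(_ isT).
    by rewrite ul le muee' ltnn.
  by have := MP _ _ l uM le; rewrite ul ltnn.
have max_below e e' u : e != e' -> mu e = mu e' -> u \in M e ->
    r e u < r e (mu e).
  move=> ee' muee' uM; have [l Hl] := dominantP _ domD u.
  have [le|le] := eqVneq l e; last first.
    by have := MP _ _ l uM le; rewrite ltnNge Hl.
  have ule : r e u <= r e (mu e) by rewrite -le Hl.
  rewrite ltn_neqAle ule andbT; apply/eqP => /r_inj ul.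
  by have := max_notin e e' u ee' muee' uM; rewrite ul muD.
(* Points of [M e] are dominated through the order [e], where [u] is their largest; any other point
   lies below some minimum [mu k] with [k != e]. *)
have max_dom e e' u : e != e' -> mu e = mu e' -> u \in M e ->
    (forall v, v \in M e -> r e v <= r e u) -> dominant (u |: D).
  move=> ee' muee' uM umax; apply/dominantP => v.
  have [vM|] := boolP (v \in M e).
    exists e => b; rewrite in_setU1 => /orP[/eqP ->|bD]; first exact: umax.
    rewrite (leq_trans (umax _ vM)) // (leq_trans (ltnW (max_below _ _ _ ee' muee' uM))) //.
    exact: mumin.
  rewrite inE negb_forall => /existsP[k]; rewrite negb_imply -leqNgt => /andP[ke vk].
  exists k => b; rewrite in_setU1 => /orP[/eqP ->|bD].
    by rewrite (leq_trans vk) // ltnW // (MP e).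
  by rewrite (leq_trans vk) // mumin.
have [ui uiM uimax] := topM i; have [uj ujM ujmax] := topM j.
have ji : j != i by rewrite eq_sym.
have uiD := max_notin _ _ _ ij muij uiM.
have ujD := max_notin _ _ _ ji (esym muij) ujM.
have uij : ui != uj.
  apply/eqP => uij; have := max_below _ _ _ ij muij uiM.
  by rewrite uij ltnNge ltnW // (MP _ _ _ ujM).
suff -> : [set B : {set U} | [&& D \subset B, dominant B & #|B| == #|I|]] =
    [set ui |: D; uj |: D].
  rewrite cards2; case: eqP => // /setP/(_ ui).
  by rewrite !in_setU1 eqxx (negbTE uiD) (negbTE uij).
apply/setP => B; rewrite !inE; apply/and3P/orP; last first.
  case=> /eqP ->; rewrite subsetUr cardsU1 ?uiD ?ujD -cardD add1n eqxx; split=> //.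
    exact: max_dom ij muij uiM uimax.
  exact: max_dom ji (esym muij) ujM ujmax.
(* Conversely, the minima of such a [B] are distinct: the added point [u] is the minimum for a
   single order [e], and the other orders keep their minima from [D]. As [i] and [j] share theirs,
   [e] is one of them, and dominance makes [u] the largest point of [M e]. *)
move=> [DB domB /eqP cardB].
have [u [uD BE]] : exists x, x \notin D /\ B = x |: D.
  by apply: subset_cardS; rewrite // cardD cardB.
have uB : u \in B by rewrite BE setU11.
have [nu [nuB numin]] := dominant_min uB.
have nu_surj := dominant_min_surj domB nuB numin.
have nu_inj : injective nu.
  have /imset_injP : #|nu @: setT| == #|[set: I]| by rewrite nu_surj cardB cardsT.
  by move=> H x y; apply: H; rewrite inE.
have nuE k : nu k != u -> nu k = mu k.
  move=> nuk; apply: (@r_inj k); apply/eqP.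
  rewrite eqn_leq numin ?(subsetP DB) //= mumin //.
  by have := nuB k; rewrite BE in_setU1 (negbTE nuk).
have [e _ ue] : exists2 e, e \in setT & u = nu e.
  by move: uB; rewrite -nu_surj => /imsetP.
have nuE' k : k != e -> nu k = mu k.
  by move=> ke; apply: nuE; rewrite ue (inj_eq nu_inj).
have uM : u \in M e.
  rewrite inE; apply/forallP => k; apply/implyP => ke.
  rewrite -nuE' // ltn_neqAle numin // andbT (inj_eq (@r_inj k)) ue.
  by rewrite (inj_eq nu_inj).
have uE v : v \in M e -> (forall w, w \in M e -> r e w <= r e v) -> u = v.
  move=> vM vmax; have [l Hl] := dominantP _ domB v.
  have [le|le] := eqVneq l e; last first.
    have := MP _ _ l vM le; rewrite ltnNge Hl //.
    by rewrite (subsetP DB) // muD.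
  by apply: (@r_inj e); apply/eqP; rewrite eqn_leq vmax //= -le Hl.
have [ei|ei] := eqVneq e i.
  by left; rewrite BE (uE ui) // ei.
have [ej|ej] := eqVneq e j.
  by right; rewrite BE (uE uj) // ej.
have := nuE' i; rewrite eq_sym ei => /(_ isT) nui.
have := nuE' j; rewrite eq_sym ej => /(_ isT) nuj.
by move: muij; rewrite -nui -nuj => /nu_inj ij'; rewrite ij' eqxx in ij.
Qed.

Variables (lab : U -> I) (i0 : I).

(* [B] plays the role of a full-dimensional simplex of a triangulation of the
   simplex with vertex set [I], and a door that of a facet bearing all the
   labels but [i0]. *)
Definition room (B : {set U}) := dominant B && (#|B| == #|I|).

Definition door (D : {set U}) :=
  [&& dominant D, #|D|.+1 == #|I| & lab @: D == [set~ i0]].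

(** If [D] is a door and [B = b |: D], then [lab] is injective on [D] and, as [B] misses a label,
    [lab b] repeats that of a single [b'] in [D]. Dropping [b] or [b'] gives the only two doors of
    [B]. *)
Lemma even_doors (B : {set U}) : room B -> lab @: B != setT ->
  odd #|[set D | door D && (D \subset B)]| = false.
Proof.
move=> /andP[domB /eqP cardB] labB.
have [-> | [D]] := set_0Vmem [set D | door D && (D \subset B)].
  by rewrite cards0.
rewrite inE => /andP[/and3P[domD /eqP cardD /eqP labD] DB].
have lab_inj : {in D &, injective lab}.
  by apply/imset_injP; rewrite labD cardsC1 -cardD.
have [b [bD BE]] : exists x, x \notin D /\ B = x |: D.
  by apply: subset_cardS; rewrite // cardD cardB.
have labb : lab b != i0.
  apply: contra labB => /eqP lb; rewrite BE imsetU1 labD lb.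
  by apply/eqP/setP => i; rewrite !inE; case: eqP.
have /imsetP[b' b'D lbb'] : lab b \in lab @: D by rewrite labD !inE.
have bb' : b != b' by apply: contraNneq bD => ->.
suff -> : [set D | door D && (D \subset B)] = [set D; B :\ b'].
  rewrite cards2; case: eqP => // /setP/(_ b').
  by rewrite b'D !inE eqxx.
apply/setP => E; rewrite !inE; apply/andP/orP; last first.
  case=> /eqP ->; first by split=> //; apply/and3P; split=> //; apply/eqP.
  have b'B : b' \in B by rewrite (subsetP DB).
  split; last exact: subD1set.
  apply/and3P; split.
  - exact: dominantS (subD1set _ _) domB.
  - by have := cardsD1 b' B; rewrite b'B add1n cardB => ->.
  - rewrite -labD; apply/eqP/setP => i; apply/imsetP/imsetP => -[u].
      rewrite !inE BE in_setU1 => /andP[ub' /orP[/eqP ->|uD]] ->.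
        by exists b'.
      by exists u.
    have [->|ub'] := eqVneq u b' => uD ->.
      by exists b; rewrite // !inE bb' BE setU11.
    by exists u; rewrite // !inE ub' (subsetP DB).
move=> [/and3P[domE /eqP cardE /eqP labE] EB].
have [e [eE BE']] : exists e, e \notin E /\ B = e |: E.
  by apply: subset_cardS; rewrite // cardE cardB.
have EE : E = B :\ e by rewrite BE' setU1K.
have [ee|eb] := eqVneq e b; first by left; rewrite EE ee BE setU1K.
have [ee|eb'] := eqVneq e b'; first by right; rewrite EE ee.
have eD : e \in D by have := setU11 e E; rewrite -BE' BE in_setU1 (negbTE eb).
have : lab e \in lab @: E by rewrite labE -labD imset_f.
move=> /imsetP[x]; rewrite EE !inE => /andP[xe]; rewrite BE in_setU1.
case/orP => [/eqP ->|xD]; last by move=> /lab_inj ex; rewrite ex ?eqxx in xe.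
by rewrite lbb' => /lab_inj ex; rewrite ex ?eqxx in eb'.
Qed.

(* Sperner's parity argument, [D0] being the only boundary door. *)
Lemma rainbow_room (D0 : {set U}) : door D0 ->
  #|[set B | room B && (D0 \subset B)]| = 1 ->
  (forall D, door D -> D != D0 -> D != set0 /\
    forall i, exists u, forall k, k != i -> exists2 b, b \in D & r k b < r k u) ->
  exists2 B, room B & lab @: B = setT.
Proof.
move=> doorD0 oneD0 aboveD.
have [/existsP[B /andP[rB /eqP lB]]|noB] :=
  boolP [exists B, room B && (lab @: B == setT)]; first by exists B.
have evenB B : room B -> odd #|[set D | door D && (D \subset B)]| = false.
  move=> rB; apply: even_doors => //; apply: contraNneq noB => lB.
  by apply/existsP; exists B; rewrite rB lB eqxx.
(* Pairs of a door inside a room are counted modulo 2: each room holds evenly many doors, while [D0]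
   lies in one room and every other door in two. *)
pose adj (B D : {set U}) : nat := D \subset B.
have sum_card (P : pred {set U}) (Q : pred {set U}) :
    \sum_(A | P A) (Q A : nat) = #|[set A | P A && Q A]|.
  rewrite -sum1_card big_mkcond [RHS]big_mkcond /=.
  by apply: eq_bigr => A _; rewrite inE; case: (P A); case: (Q A).
have : odd (\sum_(B | room B) \sum_(D | door D) adj B D) = false.
  elim/big_rec : _ => // B x rB ox; rewrite oddD ox addbF sum_card.
  exact: evenB.
rewrite exchange_big (bigD1 D0) //= oddD sum_card oneD0 /=.
suff -> : odd (\sum_(D | door D && (D != D0)) \sum_(B | room B) adj B D) = false by [].
elim/big_rec : _ => // D x /andP[dD DD0] ox; rewrite oddD ox addbF sum_card.
have [Dn0 above] := aboveD D dD DD0; have /and3P[domD /eqP cardD _] := dD.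
rewrite (_ : [set _ | _] =
    [set B : {set U} | [&& D \subset B, dominant B & #|B| == #|I|]]).
  by rewrite dominant_extensions.
by apply/setP => B; rewrite !inE andbC.
Qed.

End scarf.

(* The orders on [T] are extended to [T + I]: the slack [inr i] is the least
   element of the [i]-th order and exceeds all of [T] in the other ones, so
   that [S :|: ~: C] encodes a pair of sets [S] of [T] and [C] of [I]. *)
Lemma scarf (T I : finType) (r : I -> T -> nat) (c : T -> I) (t0 : T) :
  (forall i, injective (r i)) ->
  exists2 S : {set T}, S != set0 &
    forall t, exists2 i, i \in c @: S & forall s, s \in S -> (r i t <= r i s)%N.
Proof.
move=> r_inj.
pose M := \max_i \max_t r i t.
have rM i t : (r i t <= M)%N.
  by apply: leq_trans (leq_bigmax i); apply: (leq_bigmax t).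
(* On [T] the values are at most [M.+1], so the slacks of the other orders, starting at [M.+2], lie
   above; [enum_rank] keeps them distinct. *)
pose q i (u : T + I) := match u with
  | inl t => (r i t).+1
  | inr k => if k == i then 0 else (M.+2 + enum_rank k)%N
  end.
have q_inj i : injective (q i).
  move=> [t|k] [t'|k'] /=.
  - by move=> [/r_inj ->].
  - by case: eqP => // _ e; have := rM i t; lia.
  - by case: eqP => // _ e; have := rM i t'; lia.
  - case: eqP => [->|_]; case: eqP => [->|_] //.
    by move=> /addnI /ord_inj /enum_rank_inj ->.
pose lab (u : T + I) := match u with inl t => c t | inr i => i end.
have q0 i : q i (inr i) = 0%N by rewrite /q eqxx.
have q_big i k t : k != i -> (q i (inl t) < q i (inr k))%N.
  by move=> /negbTE ki; rewrite /q ki; have := rM i t; lia.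
pose i0 := c t0; pose D0 : {set T + I} := inr @: [set~ i0].
have D0P k : (inr k \in D0) = (k != i0).
  by rewrite mem_imset ?inE //; move=> x y [].
have D0l t : (inl t \in D0) = false by apply/imsetP => -[].
have cardD0 : #|D0|.+1 = #|I|.
  rewrite card_imset ?cardsC1; last by move=> x y [].
  by rewrite prednK //; apply/card_gt0P; exists i0.
have doorD0 : door q lab i0 D0.
  rewrite /door cardD0 eqxx /=; apply/andP; split.
    apply/dominantP => -[t|k]; last by exists k => b _; rewrite q0.
    exists i0 => -[t'|k]; first by rewrite D0l.
    by rewrite D0P => /(q_big _ _ t) /ltnW.
  apply/eqP/setP => k; rewrite !inE; apply/imsetP/idP => [[u]|ki].
    by case/imsetP => j; rewrite !inE => ji -> ->.
  by exists (inr k); rewrite ?D0P.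
(* All slacks but that of [i0] are in [D0], so only the order [i0] can dominate points of [T]: the
   one room containing [D0] adds the largest point for it. *)
pose tm := [arg max_(t > t0) r i0 t].
have tmP t : (r i0 t <= r i0 tm)%N by rewrite /tm; case: arg_maxnP => // x _; apply.
have [] := rainbow_room q_inj doorD0.
- suff -> : [set B | room q B & D0 \subset B] = [set inl tm |: D0].
    by rewrite cards1.
  apply/setP => B; rewrite !inE; apply/andP/eqP => [[/andP[domB /eqP cardB] DB]|->].
    have [u [uD BE]] := subset_cardS DB (etrans cardD0 (esym cardB)).
    case: u uD BE => [t _|k] BE.
      have [i Hi] := dominantP _ _ domB (inl tm).
      have [ii0|ii0] := eqVneq i i0; last first.
        by have := Hi (inr i); rewrite BE !inE D0P ii0 q0 => /(_ isT).
      have := Hi (inl t); rewrite BE setU11 ii0 /= ltnS => /(_ isT) tmt.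
      by rewrite (_ : tm = t) //; apply: (r_inj i0); apply/eqP; rewrite eqn_leq tmt tmP.
    move: BE; rewrite D0P negbK => /eqP -> BE.
    have [i Hi] := dominantP _ _ domB (inl t0).
    by have := Hi (inr i); rewrite BE !inE D0P q0 orbN => /(_ isT).
  split; last exact: subsetUr.
  apply/andP; split; last by rewrite cardsU1 D0l add1n cardD0.
  apply/dominantP => -[t|k]; last by exists k => b _; rewrite q0.
  exists i0 => b; rewrite in_setU1 => /orP[/eqP ->|]; first by rewrite /= ltnS.
  by case: b => [t'|k]; rewrite ?D0l // D0P => /(q_big _ _ t) /ltnW.
- move=> D /and3P[domD /eqP cardD /eqP labD] DD0.
  (* A door without a point of [T] is [D0]; given such a point, the slack of [i] lies above it in
     every order but the [i]-th. *)
  have [t tD] : exists t, inl t \in D.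
    apply/existsP; apply: contraNT DD0; rewrite negb_exists => /forallP noD.
    rewrite eqEcard -ltnS cardD0 cardD leqnn andbT.
    apply/subsetP => -[t|k]; first by rewrite (negbTE (noD t)).
    by move=> /(imset_f lab); rewrite labD D0P !inE.
  split; first by apply/set0Pn; exists (inl t).
  move=> i; exists (inr i) => k ki; exists (inl t) => //.
  by apply: q_big; rewrite eq_sym.
move=> B /andP[domB _] labB.
(* An order dominating a point of [T] cannot have its slack in [B], the slack being its least
   element. Since [B] bears all labels, that label comes from a point of [T]. *)
have HB t : exists2 i, i \in c @: [set s | inl s \in B] &
    forall s, s \in [set s | inl s \in B] -> (r i t <= r i s)%N.
  have [i Hi] := dominantP _ _ domB (inl t); exists i; last first.
    by move=> s; rewrite inE => /Hi.
  have : i \in lab @: B by rewrite labB.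
  case/imsetP => -[s|k] uB /= ik; first by rewrite ik imset_f // inE.
  by have := Hi _ uB; rewrite ik q0.
exists [set s | inl s \in B] => //; have [i /imsetP[s sS _] _] := HB t0.
by apply/set0Pn; exists s.
Qed.

(** Scarf's lemma for the grid points of total [N], ordered by coordinates. If [m j] is the least
    [j]-th coordinate in the cluster, dominance forces the sum of [m j + 1] over the labels above
    [N]. So each point of the cluster exceeds these minima, and 0 outside the labels, by at most
    [#|J|] in all. *)
Lemma scarf_grid (J : finType) (j0 : J) (N : nat)
    (c : {ffun J -> 'I_N.+1} -> J) :
  exists S : {set {ffun J -> 'I_N.+1}},
  [/\ S != set0,
      forall s, s \in S -> (\sum_j s j = N)%N,
      forall s s' j, s \in S -> s' \in S -> (s j <= s' j + #|J|)%N &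
      forall s, s \in S -> (\sum_(j | j \notin c @: S) s j <= #|J|)%N].
Proof.
pose T : finType := {t : {ffun J -> 'I_N.+1} | (\sum_j t j)%N == N}.
pose v (t : T) : {ffun J -> 'I_N.+1} := val t.
(* The order by the [j]-th coordinate, ties being broken by [enum_rank]. *)
pose r j (t : T) := (v t j * #|T| + enum_rank t)%N.
have r_inj j : injective (r j).
  move=> t t' e; apply: enum_rank_inj; apply: ord_inj.
  have := congr1 (fun n => n %% #|T|)%N e.
  by rewrite !modnMDl !modn_small.
have r_le j t t' : (r j t <= r j t')%N -> (v t j <= v t' j)%N.
  have lexi x y a b K : (x * K + a <= y * K + b -> b < K -> x <= y)%N by nia.
  by move=> rle; apply: lexi rle (ltn_ord _).
have mkT (m : J -> nat) : (\sum_j m j = N)%N -> exists t : T, forall j, v t j = m j :> nat.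
  move=> mN; have mle j : (m j < N.+1)%N by rewrite -mN (bigD1 j) //= ltnS leq_addr.
  have tN : (\sum_j [ffun j => Ordinal (mle j)] j)%N == N.
    by rewrite -[X in _ == X]mN; apply/eqP/eq_bigr => j _; rewrite ffunE.
  by exists (@exist _ (fun t : {ffun J -> 'I_N.+1} => (\sum_j t j)%N == N) _ tN) => j;
    rewrite /v /= ffunE.
have [t0 _] : exists t : T, forall j, v t j = (if j == j0 then N else 0%N) :> nat.
  by apply: mkT; rewrite -big_mkcond big_pred1_eq.
have [S0 /set0Pn[s0 s0S] Sdom] := scarf (c \o v) t0 r_inj.
pose C := (c \o v) @: S0.
pose m j := (v [arg min_(s < s0 in S0) v s j] j : nat).
have mmin j s : s \in S0 -> (m j <= v s j)%N.
  by move=> sS; rewrite /m; case: arg_minnP => // x _; apply.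
have mS j : exists2 s, s \in S0 & v s j = m j :> nat.
  by exists [arg min_(s < s0 in S0) v s j] => //; case: arg_minnP.
have sumN (t : T) : (\sum_j v t j = N)%N by case: t => t tN; apply/eqP.
have mC : (N < \sum_(j in C) (m j).+1)%N.
  (* Otherwise some grid point [t] exceeds [m] at every label, the surplus being put on [j1], and is
     not dominated. *)
  rewrite ltnNge; apply/negP => mN.
  pose j1 := c (v s0).
  have j1C : j1 \in C by rewrite imset_f.
  have [t tE] : exists t : T, forall j, v t j =
      ((if j \in C then (m j).+1 else 0) +
       (if j == j1 then N - \sum_(j in C) (m j).+1 else 0))%N :> nat.
    apply: mkT; rewrite big_split /= -!big_mkcond /= big_pred1_eq.
    by rewrite subnKC.
  have [j jC jmax] := Sdom t; have [s sS sm] := mS j.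
  have := r_le _ _ _ (jmax _ sS); rewrite sm tE jC.
  by rewrite addSn ltnNge leq_addr.
have excess s : s \in S0 ->
    (\sum_(j in C) (v s j - m j) + \sum_(j | j \notin C) v s j <= #|J|)%N.
  move=> sS; have sN : (\sum_(j in C) v s j + \sum_(j | j \notin C) v s j = N)%N.
    by rewrite -[RHS](sumN s) [RHS](bigID [in C]).
  have : (\sum_(j in C) (v s j - m j) + \sum_(j in C) m j =
          \sum_(j in C) v s j)%N.
    by rewrite -big_split /=; apply: eq_bigr => j _; rewrite subnK ?mmin.
  have : (\sum_(j in C) (m j).+1 = \sum_(j in C) m j + #|C|)%N.
    rewrite -sum1_card -big_split /=; apply: eq_bigr => j _.
    by rewrite addn1.
  have : (#|C| <= #|J|)%N := max_card _; move: mC; lia.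
exists (v @: S0).
have labE : c @: (v @: S0) = C by rewrite -imset_comp.
rewrite labE; split.
- by apply/set0Pn; exists (v s0); rewrite imset_f.
- by move=> _ /imsetP[s sS ->].
- move=> _ _ j /imsetP[s sS ->] /imsetP[s' sS' ->].
  have exc := excess s sS; have [jC|jC] := boolP (j \in C).
    have : (v s j - m j <= \sum_(k in C) (v s k - m k))%N.
      by rewrite (bigD1 j) //= leq_addr.
    move=> /leq_trans/(_ (leq_trans (leq_addr _ _) exc)).
    by rewrite leq_subLR => /leq_trans; apply; rewrite leq_add2r mmin.
  have : (v s j <= \sum_(k | k \notin C) v s k)%N by rewrite (bigD1 j) //= leq_addr.
  move=> /leq_trans/(_ (leq_trans (leq_addl _ _) exc)) /leq_trans; apply.
  exact: leq_addl.
- by move=> _ /imsetP[s sS ->]; exact: leq_trans (leq_addl _ _) (excess s sS).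
Qed.

(* Not imported earlier, as classical_sets hides lemmas of finset. *)
From mathcomp Require Import all_classical all_reals all_analysis.
Import numFieldNormedType.Exports.
Local Open Scope classical_set_scope.
Local Open Scope ring_scope.

(** * The Hahn-Banach theorem *)

Section hahn_banach.
Context (R : realType) (V : normedModType R) (K : R).
Hypothesis K_ge0 : 0 <= K.

(* Linear functionals on subspaces, given by their graphs. *)
Definition dominated_graph (G : set (V * R)) :=
  (forall t u w, G u -> G w -> G (t *: u.1 + w.1, t * u.2 + w.2)) /\
  (forall u, G u -> u.2 <= K * `|u.1|).

Lemma dominated_graph0 (G : set (V * R)) :
  G !=set0 -> dominated_graph G -> G (0, 0).
Proof.
move=> [u Gu] [Glin _].
by have := Glin (-1) _ _ Gu Gu; rewrite scaleN1r addNr mulN1r addNr.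
Qed.

(** The value [s] at [x] has to lie between all [u.2 - K * |u.1 - x|] and all [K * |w.1 + x| - w.2];
    the supremum of the former does. Rescaling by [t] gives the bound at [w.1 + t *: x]. *)
Lemma dominated_graph_extend (G : set (V * R)) (x : V) :
  G !=set0 -> dominated_graph G ->
  exists s : R, dominated_graph [set u | exists2 w, G w &
    exists t, u = (w.1 + t *: x, w.2 + t * s)].
Proof.
move=> Gn0 Gdomg; have G0 := dominated_graph0 Gn0 Gdomg.
have [Glin Gdom] := Gdomg.
have GZ t u : G u -> G (t *: u.1, t * u.2).
  by move=> Gu; have := Glin t _ _ Gu G0; rewrite !addr0.
have normrZp a (v : V) : 0 < a -> a * `|v| = `|a *: v|.
  by move=> a0; rewrite normrZ gtr0_norm.
have between u w : G u -> G w ->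
    u.2 - K * `|u.1 - x| <= K * `|w.1 + x| - w.2.
  move=> Gu Gw; rewrite lerBlDr addrAC lerBrDr -mulrDr.
  have := Gdom _ (Glin 1 _ _ Gu Gw); rewrite /= scale1r mul1r => /le_trans; apply.
  rewrite ler_wpM2l // (_ : u.1 + w.1 = (w.1 + x) + (u.1 - x)) ?ler_normD //.
  by rewrite addrACA subrr addr0 addrC.
pose L := [set u.2 - K * `|u.1 - x| | u in G]; pose s := sup L.
have Lsup : has_sup L.
  split; first by exists ((0 : R) - K * `|0 - x|); exists (0, 0).
  exists (K * `|0 + x| - 0) => _ [u Gu <-]; exact: (between u (0, 0)).
have sl u : G u -> u.2 - K * `|u.1 - x| <= s.
  by move=> Gu; apply: ub_le_sup; [case: Lsup | exists u].
have su w : G w -> s <= K * `|w.1 + x| - w.2.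
  move=> Gw; apply: ge_sup; first by case: Lsup.
  by move=> _ [u Gu <-]; apply: between.
exists s; split.
  move=> t _ _ [u Gu [a ->]] [w Gw [b ->]] /=.
  exists (t *: u.1 + w.1, t * u.2 + w.2); first exact: Glin.
  exists (t * a + b); congr (_, _).
    by rewrite scalerDr scalerA addrACA scalerDl.
  by rewrite mulrDr mulrA addrACA mulrDl.
move=> _ [w Gw [t ->]] /=.
have [t0|t0|->] := ltgtP t 0; last by rewrite scale0r mul0r !addr0; apply: Gdom.
- have tN0 : - t != 0 by rewrite oppr_eq0 lt_eqF.
  have := sl _ (GZ (- t)^-1 _ Gw); rewrite /= lerBlDr -lerBlDl.
  rewrite -(@ler_pM2l _ (- t)) ?oppr_gt0 // mulrBr mulrA mulfV // mul1r.
  rewrite mulrCA normrZp ?oppr_gt0 //.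
  by rewrite scalerBr scalerA mulfV // scale1r scaleNr opprK mulNr opprK.
- have tN0 : t != 0 by rewrite gt_eqF.
  have := su _ (GZ t^-1 _ Gw); rewrite /= lerBrDr.
  rewrite -(@ler_pM2l _ t) // mulrDr mulrA mulfV // mul1r.
  rewrite mulrCA normrZp //.
  by rewrite scalerDr scalerA mulfV // scale1r addrC.
Qed.

Theorem hahn_banach (G : set (V * R)) : G !=set0 -> dominated_graph G ->
  exists phi : {linear V -> R^o},
    (forall x, `|phi x| <= K * `|x|) /\ (forall u, G u -> phi u.1 = u.2).
Proof.
move=> Gn0 Gdom.
have [M [[Mdom MG] Mmax]] : exists M, (dominated_graph M /\ (M !=set0 -> G `<=` M)) /\
    forall B, M `<` B -> ~ (dominated_graph B /\ (B !=set0 -> G `<=` B)).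
  apply: (@Zorn_bigcup _ [set M | dominated_graph M /\ (M !=set0 -> G `<=` M)]).
  move=> F FP Ftot; split; [split|].
  - move=> t u w [A FA Au] [B FB Bw].
    have [AB|BA] := Ftot A B FA FB.
      by exists B => //; have [[+ _] _] := FP _ FB; apply => //; apply: AB.
    by exists A => //; have [[+ _] _] := FP _ FA; apply => //; apply: BA.
  - by move=> u [A FA Au]; have [[_ +] _] := FP _ FA; apply.
  - move=> [u [A FA Au]] v Gv; exists A => //.
    by have [_ +] := FP _ FA; apply => //; exists u.
have Mn0 : M !=set0.
  apply/set0P/eqP => M0; apply: (Mmax G) => //.
  rewrite M0 properEneq; split; last exact: sub0set.
  by rewrite eq_sym; apply/set0P.
  by split=> [|_ ? ?].
have GM := MG Mn0; have M0 := dominated_graph0 Mn0 Mdom.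
have [Mlin Mle] := Mdom.
have MT x : exists r, M (x, r).
  have [s Edom] := dominated_graph_extend x Mn0 Mdom.
  set E := (X in dominated_graph X) in Edom.
  have ME : M `<=` E.
    by move=> u Mu; exists u => //; exists 0; rewrite scale0r mul0r !addr0; case: u Mu.
  have [EM|nEM] := pselect (E `<=` M).
    exists s; apply: EM; exists (0, 0) => //; exists 1.
    by rewrite /= scale1r mul1r !add0r.
  case: (Mmax E) => //; split=> // _; exact: subset_trans ME.
have [phi phiM] := choice MT.
(* The difference of two values lies over the vector 0, where domination leaves only 0. *)
have Muniq x r s : M (x, r) -> M (x, s) -> r = s.
  move=> Mr Ms; apply/eqP; rewrite -subr_eq0 eq_le.
  have := Mle _ (Mlin (-1) _ _ Ms Mr); rewrite /= scaleN1r addNr normr0 mulr0 mulN1r.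
  have := Mle _ (Mlin (-1) _ _ Mr Ms); rewrite /= scaleN1r addNr normr0 mulr0 mulN1r.
  by rewrite addrC subr_le0 => ? ?; lra.
have phi_lin : linear (phi : V -> R^o).
  move=> t x y; apply: (Muniq (t *: x + y)); first exact: phiM.
  exact: (Mlin t _ _ (phiM x) (phiM y)).
pose Phi : {linear V -> R^o} := HB.pack (phi : V -> R^o)
  (GRing.isLinear.Build _ _ _ _ _ phi_lin).
exists Phi; split=> [x|[x r] Gxr]; last by apply: (Muniq x) => //; apply: GM.
rewrite ler_norml; apply/andP; split; last exact: (Mle _ (phiM x)).
rewrite lerNl -normrN -[- phi x]/(- (Phi x)) -linearN.
exact: (Mle _ (phiM (- x))).
Qed.

End hahn_banach.

(** * Convex sets and functionals on an l1-sequence *)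

Section l1_functionals.
Context (R : realType) (V : normedModType R).

Lemma convex_setP (A : set V) : convex_set (A : set (convex_lmodType V)) <->
  forall u v t, A u -> A v -> 0 <= t -> t <= 1 -> A (t *: u + (1 - t) *: v).
Proof.
split=> [cA u v t Au Av t0 t1|cA u v t].
  have := cA u v (@Itv01 _ t t0 t1); rewrite !inE; exact.
rewrite !inE => Au Av; apply: cA => //.
Qed.

Lemma convex_sum (A : set V) (x : nat -> V) (w : nat -> R) N :
  convex_set (A : set (convex_lmodType V)) -> (forall n, A (x n)) ->
  (forall n, 0 <= w n) -> 0 < \sum_(n < N) w n ->
  exists2 y, A y & \sum_(n < N) w n *: x n = (\sum_(n < N) w n) *: y.
Proof.
move=> /convex_setP cA Ax w0; elim: N => [|N IH]; first by rewrite big_ord0 ltxx.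
rewrite !big_ord_recr /=; have : 0 <= \sum_(n < N) w n by apply: sumr_ge0.
set s := \sum_(n < N) w n; rewrite le_eqVlt => /orP[/eqP s0|s0] sw.
  exists (x N) => //; rewrite -s0 add0r big1 ?add0r // => n _.
  suff -> : w n = 0 by rewrite scale0r.
  apply/eqP; rewrite eq_le w0 andbT s0 /s (bigD1 n) //= lerDl.
  exact: sumr_ge0.
have [y Ay ->] := IH s0.
exists ((s / (s + w N)) *: y + (1 - s / (s + w N)) *: x N).
  apply: cA => //; first by rewrite divr_ge0 // ltW.
  by rewrite ler_pdivrMr // mul1r lerDl.
have sw0 : s + w N != 0 by rewrite gt_eqF.
rewrite scalerDr !scalerA mulrCA mulfV // mulr1; congr (_ + _ *: _).
by rewrite mulrBr mulrCA mulfV // !mulr1 addrAC subrr add0r.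
Qed.

Lemma continuous_bounded_linear (phi : {linear V -> R^o}) (K : R) :
  (forall v, `|phi v| <= K * `|v|) -> continuous phi.
Proof.
move=> phiK; apply: bounded_linear_continuous; apply/linear_boundedP.
near=> r => v; have Kr : K <= r by near: r; apply: nbhs_pinfty_ge; exact: num_real.
exact: le_trans (phiK v) (ler_wpM2r _ Kr).
Unshelve. all: by end_near. Qed.

Lemma closed_halfspace (phi : {linear V -> R^o}) (a : R) :
  continuous phi -> closed [set v | phi v <= a].
Proof.
move=> cphi; apply: (@closed_comp _ _ phi [set r : R^o | r <= a]); last exact: closed_le.
by move=> v _; exact: cphi.
Qed.

Lemma convex_halfspace (phi : {linear V -> R^o}) (a : R) :
  convex_set ([set v | phi v <= a] : set (convex_lmodType V)).
Proof.
apply/convex_setP => u v t /= ua va t0 t1; rewrite linearD !linearZ /=.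
rewrite [X in _ <= X](_ : a = t * a + (1 - t) * a); last by ring.
by rewrite lerD // ler_wpM2l // subr_ge0.
Qed.

(** The lower l1-estimate bounds the sum of the [a n * b n] by [c^-1] times the norm of the sum of
    the [a n *: x n], so the Hahn-Banach theorem applies to the graph of finite combinations. *)
Lemma l1_functional (x : nat -> V) (c : R) (b : nat -> R) : 0 < c ->
  (forall (N : nat) (a : 'I_N -> R),
    c * \sum_(n < N) `|a n| <= `| \sum_(n < N) a n *: x n |) ->
  (forall n, `|b n| <= 1) ->
  exists phi : {linear V -> R^o},
    (forall v, `|phi v| <= c^-1 * `|v|) /\ (forall n, phi (x n) = b n).
Proof.
move=> c0 lower b1.
pose comb N (a : nat -> R) : V * R :=
  (\sum_(n < N) a n *: x n, \sum_(n < N) a n * b n).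
have combW N M a : (N <= M)%N -> comb N a = comb M (fun n => if (n < N)%N then a n else 0).
  move=> NM; rewrite /comb (big_ord_widen M (fun n => a n *: x n) NM).
  rewrite (big_ord_widen M (fun n => a n * b n) NM) /=; congr (_, _); rewrite big_mkcond.
    by apply: eq_bigr => n _; case: ifP; rewrite ?scale0r.
  by apply: eq_bigr => n _; case: ifP; rewrite ?mul0r.
have combD t N a a' : (t *: (comb N a).1 + (comb N a').1,
    t * (comb N a).2 + (comb N a').2) = comb N (fun n => t * a n + a' n).
  rewrite /comb /= scaler_sumr mulr_sumr -!big_split /=; congr (_, _).
    by apply: eq_bigr => n _; rewrite scalerDl scalerA.
  by apply: eq_bigr => n _; rewrite mulrDl mulrA.
have c'0 : 0 <= c^-1 by rewrite invr_ge0 ltW.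
have [||phi [phiK phiG]] := hahn_banach c'0 (G := [set u | exists N a, u = comb N a]).
- by exists (comb 0%N (fun=> 0)), 0%N, (fun=> 0).
- split=> [t _ _ [N [a ->]] [M [a' ->]]|_ [N [a ->]]].
    rewrite (combW N (maxn N M)) ?leq_maxl // (combW M (maxn N M)) ?leq_maxr //.
    by rewrite combD; do 2 eexists.
  rewrite ler_pdivlMl //; apply: le_trans (lower N (fun n => a n)).
  apply: ler_wpM2l; first exact: ltW.
  apply: ler_sum => n _; apply: (le_trans (ler_norm _)).
  by rewrite normrM ler_piMr.
exists phi; split=> // n.
pose d m : R := (m == n)%:R.
have dE : comb n.+1 d = (x n, b n).
  rewrite /comb !big_ord_recr /= /d eqxx scale1r mul1r !big1 ?add0r //.
    by move=> i _; rewrite ltn_eqF ?mul0r.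
  by move=> i _; rewrite ltn_eqF ?scale0r.
by have := phiG (comb n.+1 d); rewrite dE /=; apply; exists n.+1, d.
Qed.

End l1_functionals.

(** * A map without weak approximate fixed points *)

Lemma telescope_down (M : zmodType) (f : nat -> M) m n : (m <= n)%N ->
  \sum_(m <= k < n) (f k - f k.+1) = f m - f n.
Proof.
move=> mn; rewrite -[RHS]opprB -telescope_sumr // -sumrN.
by under [RHS]eq_bigr do rewrite opprB.
Qed.

Section l1_simplex.
Context (R : realType) (V : normedModType R) (x : nat -> V).

Definition closed_hull : set V :=
  \bigcap_(A in [set A | [/\ closed A, convex_set (A : set (convex_lmodType V)) &
                         forall n, A (x n)]]) A.

Lemma closed_hull_sub (A : set V) : closed A ->
  convex_set (A : set (convex_lmodType V)) -> (forall n, A (x n)) ->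
  closed_hull `<=` A.
Proof. by move=> cA vA Ax u; apply. Qed.

Lemma closed_closed_hull : closed closed_hull.
Proof. by apply: closed_bigI => A []. Qed.

Lemma convex_closed_hull : convex_set (closed_hull : set (convex_lmodType V)).
Proof.
apply/convex_setP => u v t Du Dv t0 t1 A AP; have [_ /convex_setP cA _] := AP.
by apply: cA => //; [apply: Du | apply: Dv].
Qed.

Lemma closed_hull_gen n : closed_hull (x n).
Proof. by move=> A []. Qed.

Lemma closed_hull_linear_le (phi psi : {linear V -> R^o}) :
  continuous phi -> continuous psi -> (forall n, phi (x n) <= psi (x n)) ->
  forall u, closed_hull u -> phi u <= psi u.
Proof.
move=> cphi cpsi phipsi.
pose d : {linear V -> R^o} := phi \- psi.
have cd : continuous d by move=> u; apply: cvgB; [exact: cphi|exact: cpsi].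
move=> u Du; rewrite -subr_le0; have dx n : d (x n) <= 0 by rewrite subr_le0.
have : [set v | d v <= 0] u; last by [].
apply: closed_hull_sub Du => //; [exact: closed_halfspace|exact: convex_halfspace].
Qed.

Lemma closed_hull_le (phi : {linear V -> R^o}) a :
  continuous phi -> (forall n, phi (x n) <= a) ->
  forall u, closed_hull u -> phi u <= a.
Proof.
move=> cphi phia; apply: closed_hull_sub phia;
  [exact: closed_halfspace|exact: convex_halfspace].
Qed.

(** * Tail functionals and the mass shift on the closed hull *)

Variables (K : R) (T : nat -> {linear V -> R^o}).
Hypothesis TK : forall n v, `|T n v| <= K * `|v|.
Hypothesis Tx : forall n j, T n (x j) = (n <= j)%N%:R.

Lemma tail_continuous n : continuous (T n).
Proof. exact: continuous_bounded_linear (TK n). Qed.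

Lemma tail_mono n m u : closed_hull u -> (n <= m)%N -> T m u <= T n u.
Proof.
move=> Du nm; apply: closed_hull_linear_le Du => [||j]; [exact: tail_continuous..|].
rewrite !Tx ler_nat; case: (leqP m j) => // mj.
by rewrite (leq_trans nm mj).
Qed.

Lemma tail_le1 n u : closed_hull u -> T n u <= 1.
Proof. by apply: closed_hull_le => [|j]; [exact: tail_continuous|rewrite Tx lern1 leq_b1]. Qed.

Lemma tail0 u : closed_hull u -> T 0%N u = 1.
Proof.
move=> Du; apply/eqP; rewrite eq_le tail_le1 //=.
pose NT : {linear V -> R^o} := \- T 0%N.
have cN : continuous NT by move=> v; apply: cvgN; exact: tail_continuous.
have := closed_hull_le (a := -1) cN _ Du; rewrite lerN2; apply.
by move=> n; rewrite /NT /= Tx leq0n.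
Qed.

(** The vectors whose tails are eventually below every positive bound form a convex set, closed
    because the [T n] share the bound [K], and containing each [x j]. *)
Lemma tail_vanish u e : closed_hull u -> 0 < e -> exists n, T n u < e.
Proof.
move=> Du e0.
suff : [set v | forall e, 0 < e -> exists n, forall m, (n <= m)%N -> T m v <= e] u.
  move=> /(_ (e / 2) (divr_gt0 e0 (ltr0Sn _ _)))[n Hn]; exists n.
  by apply: le_lt_trans (Hn n _) _ => //; lra.
apply: closed_hull_sub Du => [v clv {}e {}e0||j {}e {}e0].
- have Ke : 0 < e / 2 / (`|K| + 1) by rewrite divr_gt0 ?divr_gt0 // ltr_wpDl.
  have [w [/= Hw vw]] := clv _ (nbhsx_ballx v _ Ke).
  have [n Hn] := Hw (e / 2) (divr_gt0 e0 (ltr0Sn _ _)); exists n => m nm.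
  have := Hn m nm; move: vw; rewrite -ball_normE /= => vw.
  have := TK m (v - w); rewrite linearB /= => /(le_trans (ler_norm _)) TKvw.
  have : K * `|v - w| <= e / 2.
    apply: (le_trans (ler_wpM2r (normr_ge0 _) (ler_norm K))).
    apply: (@le_trans _ _ ((`|K| + 1) * `|v - w|)).
      by rewrite ler_wpM2r // lerDl.
    by rewrite mulrC -ler_pdivlMr ?ltW // ltr_wpDl.
  lra.
- apply/convex_setP => v w t Hv Hw t0 t1 e' e'0.
  have [n Hn] := Hv _ e'0; have [m Hm] := Hw _ e'0; exists (maxn n m) => k.
  rewrite geq_max => /andP[nk mk]; rewrite linearD !linearZ /=.
  rewrite [X in _ <= X](_ : e' = t * e' + (1 - t) * e'); last by ring.
  by rewrite lerD // ler_wpM2l ?subr_ge0 // ?Hn ?Hm.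
- by exists j.+1 => m jm; rewrite Tx leqNgt jm ltW.
Qed.

(* Any continuous nondecreasing function which is 0 near 0 and 1 near 1 would
   do: the former makes [mass_shift] locally a finite sum, the latter pushes
   the tails towards 1. *)
Definition clamp (t : R) : R := Num.max 0 (Num.min 1 (2 * t - 1 / 2)).

Lemma clamp_ge0 t : 0 <= clamp t.
Proof. by rewrite /clamp le_max lexx. Qed.

Lemma clamp_le1 t : clamp t <= 1.
Proof. by rewrite /clamp ge_max ler01 ge_min lexx. Qed.

Lemma clamp_homo s t : s <= t -> clamp s <= clamp t.
Proof.
by move=> st; rewrite /clamp /Num.max /Num.min; do ![case: ifPn]; rewrite -?leNgt => *; lra.
Qed.

Lemma clamp0 t : t <= 1 / 4 -> clamp t = 0.
Proof.
by move=> st; rewrite /clamp /Num.max /Num.min; do ![case: ifPn]; rewrite -?leNgt => *; lra.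
Qed.

Lemma clamp1 t : 3 / 4 <= t -> clamp t = 1.
Proof.
by move=> st; rewrite /clamp /Num.max /Num.min; do ![case: ifPn]; rewrite -?leNgt => *; lra.
Qed.

Lemma clamp_continuous : continuous (clamp : R^o -> R^o).
Proof.
move=> t; apply: (@continuous_max R R^o (fun=> 0) (fun t => Num.min 1 (2 * t - 1 / 2))).
  exact: cvg_cst.
apply: (@continuous_min R R^o (fun=> 1) (fun t => 2 * t - 1 / 2)); first exact: cvg_cst.
by apply: cvgB; [apply: cvgM; [exact: cvg_cst|exact: cvg_id]|exact: cvg_cst].
Qed.

(** The tails of the shifted point: those of [u], clamped and moved up by one index, preceded by the
    total mass 1. *)
Definition shifted_tail n u : R := if n is m.+1 then clamp (T m u) else 1.

Local Notation S := shifted_tail.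

Lemma shifted_tail_ge0 n u : 0 <= S n u.
Proof. by case: n => [|n] /=; [exact: ler01|exact: clamp_ge0]. Qed.

Lemma shifted_tail_le1 n u : S n u <= 1.
Proof. by case: n => [|n] /=; [exact: lexx|exact: clamp_le1]. Qed.

Lemma shifted_tail_mono n m u : closed_hull u -> (n <= m)%N -> S m u <= S n u.
Proof.
move=> Du; case: n m => [|n] [|m] //=; first by rewrite clamp_le1.
by move=> nm; apply: clamp_homo; apply: tail_mono.
Qed.

Definition shift_sum N u : V := \sum_(n < N) (S n u - S n.+1 u) *: x n.

Lemma shift_sum_eq N M u : closed_hull u -> S N u = 0 -> S M u = 0 ->
  shift_sum N u = shift_sum M u.
Proof.
move=> Du; wlog NM : N M / (N <= M)%N => [H SN SM|SN _].
  by case: (leqP N M) => [|/ltnW] ?; [apply: H|apply/esym; apply: H].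
have S0 k : (N <= k)%N -> S k u = 0.
  move=> Nk; apply/eqP; rewrite eq_le shifted_tail_ge0 andbT -SN.
  exact: shifted_tail_mono.
rewrite /shift_sum (big_ord_widen M (fun n => (S n u - S n.+1 u) *: x n) NM).
rewrite big_mkcond; apply: eq_bigr => n _; case: ltnP => // Nn.
by rewrite !S0 ?subrr ?scale0r // leqW.
Qed.

Lemma shifted_tail_vanish u : closed_hull u -> exists N, S N u = 0.
Proof.
move=> Du; have [|n Tn] := @tail_vanish u (1 / 4) Du; first lra.
by exists n.+1; apply: clamp0; apply: ltW.
Qed.

(* On [closed_hull] any [N] with [S N u = 0] yields the same sum. *)
Definition mass_shift u : V := shift_sum (xget 0%N [set N | S N u = 0]) u.

Lemma mass_shiftE N u : closed_hull u -> S N u = 0 -> mass_shift u = shift_sum N u.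
Proof.
move=> Du SN; apply: shift_sum_eq => //.
by apply: (@xgetPex _ _ [set N | S N u = 0]); exists N.
Qed.

Lemma shift_sum_continuous N : continuous (shift_sum N).
Proof.
have cS n : continuous (S n : V -> R^o).
  case: n => [|n] u /=; first exact: cvg_cst.
  apply: (@continuous_comp V R^o R^o (T n) clamp).
    exact: tail_continuous.
  exact: clamp_continuous.
move=> u; elim: N => [|N IH].
  rewrite [shift_sum _](_ : _ = fun=> 0) ?[X in _ --> X]big_ord0.
    exact: cvg_cst.
  by apply/funext => v; rewrite /shift_sum big_ord0.
rewrite [shift_sum _](_ : _ = fun v => shift_sum N v + (S N v - S N.+1 v) *: x N).
  by apply: cvgD => //; apply: cvgZr_tmp; apply: cvgB; apply: cS.
by apply/funext => v; rewrite /shift_sum big_ord_recr.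
Qed.

(** The inequality [T n v < 1 / 4] persists near [u], and there the map is the single finite sum
    [shift_sum n.+1]. *)
Lemma mass_shift_continuous : {within closed_hull, continuous mass_shift}.
Proof.
apply/subspace_continuousP => u Du.
have [|n Tn] := @tail_vanish u (1 / 4) Du; first lra.
have SE v : closed_hull v -> T n v < 1 / 4 -> mass_shift v = shift_sum n.+1 v.
  by move=> Dv Tv; apply: mass_shiftE => //; apply: clamp0; apply: ltW.
rewrite /from_subspace/= SE //.
apply: cvg_trans (cvg_within_filter _ (@shift_sum_continuous n.+1 u)).
apply: near_eq_cvg; rewrite near_withinE.
have : \forall v \near u, T n v < 1 / 4.
  have := @tail_continuous n u; move=> /cvgr_lt; exact.
by apply: filterS => v Tv Dv; rewrite SE.
Qed.

Lemma mass_shift_closed_hull u : closed_hull u -> closed_hull (mass_shift u).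
Proof.
move=> Du; have [N SN] := shifted_tail_vanish Du; rewrite (mass_shiftE Du SN).
have tele : \sum_(n < N) (S n u - S n.+1 u) = 1.
  rewrite -(big_mkord xpredT (fun n => S n u - S n.+1 u)).
  by rewrite (telescope_down (S^~ u)) // SN subr0.
have [||||y Dy] := @convex_sum _ _ closed_hull x (fun n => S n u - S n.+1 u) N.
- exact: convex_closed_hull.
- exact: closed_hull_gen.
- by move=> n; rewrite subr_ge0 shifted_tail_mono.
- by rewrite tele ltr01.
by rewrite /shift_sum => ->; rewrite tele scale1r.
Qed.

Lemma functional_shift (phi : {linear V -> R^o}) N u :
  phi (shift_sum N u) = \sum_(n < N) (S n u - S n.+1 u) * phi (x n).
Proof. by rewrite linear_sum; apply: eq_bigr => n _; rewrite linearZ. Qed.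

Lemma tail_shift n u : closed_hull u -> T n (mass_shift u) = S n u.
Proof.
move=> Du; have [N SN] := shifted_tail_vanish Du.
have S0 k : (N <= k)%N -> S k u = 0.
  move=> Nk; apply/eqP; rewrite eq_le shifted_tail_ge0 andbT -SN.
  exact: shifted_tail_mono.
have nM := leq_maxl n N; have SM := S0 _ (leq_maxr n N).
rewrite (mass_shiftE Du SM) functional_shift; set M := maxn n N in nM SM *.
rewrite -(big_mkord xpredT (fun k => (S k u - S k.+1 u) * T n (x k))).
rewrite (@big_cat_nat _ _ _ n) //= [X in X + _]big_nat_cond big1 => [|k]; last first.
  by rewrite andbT => /andP[_ kn]; rewrite Tx leqNgt kn mulr0.
rewrite add0r -[RHS]subr0 -[X in _ = _ - X]SM -(telescope_down (S^~ u)) //.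
by apply: eq_big_nat => k /andP[nk _]; rewrite Tx nk mulr1.
Qed.

Hypothesis indicator : forall B : set nat, exists2 phi : {linear V -> R^o},
  continuous phi & forall n, phi (x n) = (n \in B)%:R.

Lemma mass_shift_not_weak_afpp : ~ weak_afpp closed_hull.
Proof.
move=> /(_ mass_shift mass_shift_closed_hull mass_shift_continuous) [u Du wu].
have Tu n : (T n (u k) - S n (u k)) @[k --> \oo] --> (0 : R^o).
  have := wu (T n) (@tail_continuous n); rewrite linear0.
  by under eq_cvg do rewrite linearB /= tail_shift //.
(* Once [T n (u k)] exceeds 3/4, the next shifted tail is exactly 1, and [T n.+1 (u k)] approaches
   it. *)
have T1 n e : 0 < e -> \forall k \near \oo, 1 - e < T n (u k).
  elim: n e => [|n IH] e e0.
    by near=> k; rewrite tail0 // ltrBlDr ltrDl.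
  have e14 : (0 : R) < 1 / 4 by lra.
  have := IH _ e14; have := Tu n.+1 => /cvgr_gt/(_ (- e)).
  rewrite oppr_lt0 => /(_ e0); apply: filterS2 => k /= Tk Tnk.
  by move: Tk; rewrite clamp1; lra.
have T78 n m : exists2 k, (m <= k)%N & 7 / 8 <= T n (u k).
  have e18 : (0 : R) < 1 / 8 by lra.
  have [N _ HN] := T1 n _ e18; exists (maxn m N); rewrite ?leq_maxl //.
  by have := HN (maxn m N) (leq_maxr _ _); rewrite /=; lra.
(* Take the first index whose tail is below 3/4. The tail before it is clamped to 1, so the shifted
   point carries no mass before this index. *)
have Su k : exists n, S n (u k) = 1 /\ T n (u k) < 3 / 4.
  have [|n Tn] := @tail_vanish (u k) (3 / 4) (Du k); first lra.
  have ex : exists n, T n (u k) < 3 / 4 by exists n.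
  exists (ex_minn ex); case: ex_minnP => -[|m] Tm mmin.
    by move: Tm; rewrite tail0 // => ?; lra.
  split=> //; apply: clamp1; rewrite leNgt; apply/negP => /mmin.
  by rewrite ltnn.
have [p Sp] := choice Su.
have [q Sq] := choice (fun k => shifted_tail_vanish (Du k)).
have [a|kk Hkk] := @choice (nat * nat) nat
    (fun a k => (a.2 <= k)%N /\ 7 / 8 <= T a.1 (u k)).
  by have [k] := T78 a.1 a.2; exists k.
(* The [j]-th point is chosen with mass at least 7/8 from [l j] on; [l j.+1] is where the tail of
   its shifted image vanishes. *)
pose l := fix l j := if j is i.+1 then q (kk (l i, i)) else 0%N.
pose k j := kk (l j, j).
have kj j : (j <= k j)%N by have [] := Hkk (l j, j).
have Tlk j : 7 / 8 <= T (l j) (u (k j)) by have [] := Hkk (l j, j).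
have pq i : (p i < q i)%N.
  rewrite ltnNge; apply/negP => /(shifted_tail_mono (Du i)).
  by have [-> _] := Sp i; rewrite Sq ler10.
have lp j : (l j < p (k j))%N.
  rewrite ltnNge; apply/negP => /(tail_mono (Du (k j))).
  by have [_] := Sp (k j); have := Tlk j; lra.
have lS j : (p (k j) < l j.+1)%N by exact: pq.
have l_homo i j : (i <= j)%N -> (l i <= l j)%N.
  move=> /subnKC <-; elim: (j - i)%N => [|d IH]; first by rewrite addn0.
  by rewrite addnS (leq_trans IH) // ltnW // (ltn_trans (lp _)).
(* The humps: [u (k j)] has mass at least 1/8 on the [j]-th interval, while
   [mass_shift (u (k j))] lives between [p (k j)] and [l j.+1]. *)
pose B := [set n | exists j, (l j <= n < p (k j))%N].
have [phi cphi phix] := indicator B.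
have phi0 j : phi (mass_shift (u (k j))) = 0.
  rewrite (mass_shiftE (Du _) (Sq _)) functional_shift big1 // => -[n /= nq] _.
  have [np|pn] := ltnP n (p (k j)).
    have S1 m : (m <= p (k j))%N -> S m (u (k j)) = 1.
      move=> mp; apply/eqP; rewrite eq_le shifted_tail_le1 /=.
      by have [<- _] := Sp (k j); apply: shifted_tail_mono.
    by have := S1 _ np; rewrite /= => ->; rewrite S1 ?subrr ?mul0r // ltnW.
  rewrite phix (_ : (n \in B) = false) ?mulr0 //.
  apply/negbTE; rewrite notin_setE => -[i /andP[li ip]].
  have [ij|ij|ij] := ltngtP i j.
  - have := leq_trans (lS i) (l_homo _ _ ij); have := lp j; lia.
  - have := l_homo _ _ ij; have : (q (k j) = l j.+1)%N by []; lia.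
  - by move: ip; rewrite ij ltnNge pn.
(* The mass on the [j]-th interval is [T (l j) - T (p (k j))], which is at least 7/8 - 3/4. *)
have phi18 j : 1 / 8 <= phi (u (k j)).
  pose d : {linear V -> R^o} := T (l j) \- T (p (k j)).
  have cd : continuous d.
    by move=> v; apply: cvgB; exact: tail_continuous.
  have : d (u (k j)) <= phi (u (k j)).
    apply: closed_hull_linear_le => // n; rewrite /d /= !Tx phix.
    have [ln|ln] := leqP (l j) n; have [pn|pn] := leqP (p (k j)) n.
    - by rewrite subrr ler0n.
    - rewrite subr0 (_ : n \in B) // inE; exists j; rewrite ln pn //.
    - by rewrite sub0r (le_trans (lerN10 _)) ?ler0n.
    - by rewrite subrr ler0n.
  by rewrite /d /=; have [_] := Sp (k j); have := Tlk j; lra.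
have e18 : (0 : R) < 1 / 8 by lra.
have /cvgr_lt := wu phi cphi; rewrite linear0 => /(_ _ e18)[N _ /(_ (k N) (kj N))] /=.
by rewrite linearB /= phi0 subr0 ltNge phi18.
Unshelve. all: by end_near. Qed.

End l1_simplex.

Theorem weak_afpp_no_l1 (R : realType) (V : normedModType R) (C : set V) :
  closed C -> convex_set (C : set (convex_lmodType V)) ->
  (forall D : set V, D `<=` C -> D !=set0 -> closed D ->
     convex_set (D : set (convex_lmodType V)) -> weak_afpp D) ->
  ~ exists2 x : nat -> V, (forall n, C (x n)) & equivalent_l1_basis x.
Proof.
move=> clC cvC afpp [x Cx [_ [c c0 lower]]].
have ind (B : set nat) : exists phi : {linear V -> R^o},
    (forall v, `|phi v| <= c^-1 * `|v|) /\ forall n, phi (x n) = (n \in B)%:R.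
  by apply: (l1_functional c0 lower) => n; rewrite normr_nat lern1 leq_b1.
have [T HT] := choice (fun n => ind [set j | (n <= j)%N]).
apply: (@mass_shift_not_weak_afpp _ _ x c^-1 T).
- by move=> n; have [] := HT n.
- by move=> n j; have [_ ->] := HT n; rewrite mem_setE.
- move=> B; have [phi [phiK phix]] := ind B; exists phi => //.
  exact: continuous_bounded_linear phiK.
apply: afpp.
- exact: closed_hull_sub.
- by exists (x 0%N); apply: closed_hull_gen.
- exact: closed_closed_hull.
- exact: convex_closed_hull.
Qed.

(** * The Ramsey dichotomy for ultrafilters *)

Section ultra_dichotomy.
Context (I : countType) (U : set_system I) {UF : UltraFilter U}.
Context (Phi : Type) (H : bool -> Phi -> I -> Prop).

Definition realized (s : seq (I * bool)) :=
  exists phi, forall a, a \in s -> H a.2 phi a.1.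

(** A pair [(n, v)] demands that [phi] lie on side [v] at [n]. Derivations are the well-founded
    trees of large sets that obstruct the choice of independent points. *)
Inductive blocked : seq (I * bool) -> Prop :=
| blocked_now s : ~ realized s -> blocked s
| blocked_later s v A : U A ->
    (forall n, A n -> blocked ((n, v) :: s)) -> blocked s.

Lemma unblocked_next s v : ~ blocked s -> U [set n | ~ blocked ((n, v) :: s)].
Proof.
move=> ns.
have [Ub|//] := @in_ultra_setVsetC _ _ [set n | blocked ((n, v) :: s)] UF.
by case: ns; apply: (blocked_later (v := v) Ub).
Qed.

(** Every assignment of sides to the points chosen so far is kept unblocked. Each of these finitely
    many assignments allows a large set of next points, and these sets have a common point. *)
Lemma unblocked_independent : ~ blocked [::] -> exists m : nat -> I,
  forall N (v : nat -> bool), exists phi, forall i, (i < N)%N -> H (v i) phi (m i).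
Proof.
move=> nb.
pose free (l : seq I) := forall w : seq bool, size w = size l -> ~ blocked (zip l w).
have next l : exists n, free l -> free (n :: l).
  have [fl|] := pselect (free l); last first.
    by move=> nfl; have [n _] := @filter_ex _ U _ setT filterT; exists n.
  suff /filter_ex [n Hn] : U [set n | forall c : (size l).+1.-tuple bool,
      ~ blocked (zip (n :: l) c)].
    exists n => _ w sw; have sw' : size w == (size l).+1 by rewrite sw.
    exact: (Hn (Tuple sw')).
  apply: filter_forall => c; case: c => -[|v w] //= /eqP[sw].
  by apply: unblocked_next; apply: fl.
have [g Hg] := choice next.
pose L := fix L N := if N is N'.+1 then g (L N') :: L N' else [::].
have sizeL N : size (L N) = N by elim: N => //= N ->.
have freeL N : free (L N).
  elim: N => [|N IH]; last exact: Hg.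
  by move=> [].
exists (fun i => g (L i)) => N v.
pose W := fix W N := if N is N'.+1 then v N' :: W N' else [::].
have sizeW M : size (W M) = M by elim: M => //= M ->.
have : realized (zip (L N) (W N)).
  apply: contrapT => nr; apply: (freeL N (W N)); first by rewrite sizeL sizeW.
  exact: blocked_now.
move=> [phi Hphi]; exists phi => i iN.
apply: (Hphi (g (L i), v i)); elim: N iN {Hphi} => // N IH.
rewrite ltnS leq_eqVlt => /orP[/eqP ->|/IH iN]; first by rewrite /= mem_head.
by rewrite /= in_cons iN orbT.
Qed.

Definition eventually_in (A : nat -> set I) (m : nat -> I) :=
  forall j, \forall i \near \oo, A j (m i).

(* The large sets occurring in a derivation of [blocked s] are indexed by
   finite sequences of elements of the countable type [I]. *)
Lemma blocked_selector s : blocked s -> exists A : nat -> set I,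
  (forall j, U (A j)) /\
  forall m, eventually_in A m -> forall phi v, U [set n | H v phi n] ->
    (forall a, a \in s -> H a.2 phi a.1) ->
    \forall i \near \oo, ~ H (~~ v) phi (m i).
Proof.
elim=> {s} [s nr|s w A UA _ IH].
  exists (fun=> setT); split=> [j|m _ phi v _ Hs]; first exact: filterT.
  by case: nr; exists phi.
have IH' n : exists B : nat -> set I, (forall j, U (B j)) /\ (A n ->
    forall m, eventually_in B m -> forall phi v, U [set n | H v phi n] ->
    (forall a, a \in (n, w) :: s -> H a.2 phi a.1) ->
    \forall i \near \oo, ~ H (~~ v) phi (m i)).
  have [/IH[B [UB HB]]|nA] := pselect (A n); first by exists B.
  by exists (fun=> setT); split=> [j|//]; exact: filterT.
have [B HB] := choice IH'.
pose C k := if (unpickle k : option (option (I * nat))) is Some (Some (n, j))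
  then B n j else A.
exists C; split=> [k|m Cm phi v Uv Hs].
  by rewrite /C; case: unpickle => [[[n j]|]|] //; have [] := HB n.
have Am : \forall i \near \oo, A (m i).
  have := Cm (pickle (None : option (I * nat))).
  by rewrite /C pickleK.
have Bm n : eventually_in (B n) m.
  move=> j; have := Cm (pickle (Some (n, j) : option (I * nat))).
  by rewrite /C pickleK.
have step n : A n -> H w phi n -> \forall i \near \oo, ~ H (~~ v) phi (m i).
  move=> An Hn; have [_ HBn] := HB n; apply: (HBn An m (Bm n) phi v Uv).
  by move=> a; rewrite in_cons => /orP[/eqP ->|/Hs].
(* A point of [A] where [phi] is on side [w] leads to a subtree. If [w = v], it exists because two
   large sets meet; otherwise a term of the sequence is such a point, unless no term in [A] is on
   side [~~ v], which is the claim. *)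
have [wv|wv] := eqVneq w v.
  have [n [An Hn]] := filter_ex (filterI UA Uv).
  by apply: (step n An); rewrite wv.
have {}wv : w = ~~ v by case: w v wv {IH IH' HB step B C Cm Bm Uv} => -[].
have [[i [Ai Hi]]|no] := pselect (exists i, A (m i) /\ H (~~ v) phi (m i)).
  by apply: (step (m i)); rewrite ?wv.
by apply: filterS Am => i Ai Hi; apply: no; exists i.
Qed.

End ultra_dichotomy.

(** * Weakly convergent selections *)

Lemma ultra_bounded_cvg (R : realType) (I : Type) (U : set_system I)
    {UF : UltraFilter U} (g : I -> R) (M : R) :
  (forall n, `|g n| <= M) -> exists L : R, g @ U --> L.
Proof.
move=> gM; have := @segment_compact R (- M) M.
move=> /(_ (g @ U) _)[].
  apply: (@filterS _ U _ setT _ _ filterT) => n _ /=.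
  by rewrite in_itv /= -ler_norml.
move=> L [_ clL]; exists L => B nB.
have [//|UnB] := @in_ultra_setVsetC _ _ (g @^-1` B) UF.
by have [r [nBr Br]] := clL (~` B) B UnB nB.
Qed.

Lemma countable_diagonal (I : Type) (U : set_system I) {UF : ProperFilter U}
    (A : nat -> set I) : (forall j, U (A j)) ->
  exists m : nat -> I, forall j, \forall i \near \oo, A j (m i).
Proof.
move=> UA.
have ex i : exists n, forall j, (j <= i)%N -> A j n.
  suff /filter_ex [n Hn] : U [set n | forall j : 'I_i.+1, A j n].
    by exists n => j ji; apply: (Hn (Ordinal (ji : (j < i.+1)%N))).
  by apply: filter_forall => j; apply: UA.
have [m Hm] := choice ex.
by exists m => j; exists j => // i /= ji; apply: Hm.
Qed.

Section l1_free_selection.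
Context (R : realType) (V : normedModType R).
Context (I : countType) (U : set_system I) {UF : UltraFilter U}.
Variables (z : I -> V) (M : R).
Hypothesis z_bounded : forall n, `|z n| <= M.
Hypothesis z_no_l1 : forall m : nat -> I, ~ equivalent_l1_basis (z \o m).

(** A uniform bound is what yields an l1-constant; taking it in the natural numbers leaves countably
    many cases. *)
Let bounded_functional (k : nat) :=
  {phi : {linear V -> R^o} | forall v, `|phi v| <= k%:R * `|v|}.

Let side (k : nat) (a b : R) (v : bool) (phi : bounded_functional k) (n : I) :=
  if v then b <= sval phi (z n) else sval phi (z n) <= a.

(** Let [p] be on the upper side where the coefficient is nonnegative and on the lower side
    elsewhere, and [q] the other way round. Then [p y - q y] is at least [b - a] times the sum of
    the [|c n|], and at most [2 * k] times the norm of [y]. *)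
Lemma independent_l1 (k : nat) (a b : R) (m : nat -> I) : a < b ->
  (forall N (v : nat -> bool), exists phi : bounded_functional k,
     forall i, (i < N)%N -> side a b (v i) phi (m i)) ->
  equivalent_l1_basis (z \o m).
Proof.
move=> ab ind; split.
  exists M; split; first exact: num_real.
  by move=> r Mr n _ /=; apply: le_trans (ltW Mr).
(* The successor keeps the constant positive for [k = 0]. *)
exists ((b - a) / (2 * k.+1%:R)); first by rewrite divr_gt0 ?subr_gt0 // mulr_gt0.
move=> N c; pose y := \sum_(n < N) c n *: (z \o m) n; rewrite -/y.
pose w i := if insub i is Some j then 0 <= c j else true.
have wE (i : 'I_N) : w i = (0 <= c i).
  by rewrite /w insubT // => ?; congr (_ <= c _); apply: val_inj.
have [[p pk] Hp] := ind N w; have [[q qk] Hq] := ind N (fun i => ~~ w i).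
have phiy (phi : {linear V -> R^o}) : phi y = \sum_(n < N) c n * phi (z (m n)) :> R.
  by rewrite linear_sum; apply: eq_bigr => n _; rewrite linearZ.
have : (b - a) * \sum_(n < N) `|c n| <= p y - q y.
  rewrite !phiy -sumrB mulr_sumr; apply: ler_sum => n _.
  have := Hp _ (ltn_ord n); have := Hq _ (ltn_ord n); rewrite /side wE /=.
  move: (p (z (m n))) (q (z (m n))) => P Q.
  case: (lerP 0 (c n)) => cn /= Qn Pn; first by rewrite ger0_norm //; nra.
  by rewrite ltr0_norm //; nra.
have := le_trans (ler_norm _) (pk y).
have : - q y <= k%:R * `|y|.
  by rewrite lerNl; have := qk y; rewrite ler_norml => /andP[].
have ky : k%:R * `|y| <= k.+1%:R * `|y| by rewrite ler_wpM2r // ler_nat.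
move=> qy py pq; rewrite mulrAC ler_pdivrMr ?mulr_gt0 // (le_trans pq) //.
by rewrite mulrC -mulrA; lra.
Qed.

Lemma pair_selector (k : nat) (a b : R) : a < b ->
  exists A : nat -> set I, (forall j, U (A j)) /\
    forall m, (forall j, \forall i \near \oo, A j (m i)) ->
    forall phi : bounded_functional k,
      (U [set n | sval phi (z n) <= a] ->
        \forall i \near \oo, sval phi (z (m i)) < b) /\
      (U [set n | b <= sval phi (z n)] ->
        \forall i \near \oo, a < sval phi (z (m i))).
Proof.
move=> ab; have [bl|nbl] := pselect (blocked U (side (k := k) a b) [::]); last first.
  have [m Hm] := unblocked_independent nbl.
  by case: (@z_no_l1 m); apply: independent_l1 ab Hm.
have [A [UA HA]] := blocked_selector bl; exists A; split=> // m Am phi; split=> Uphi.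
  have := HA m Am phi false Uphi (fun _ => ltac:(by [])).
  by apply: filterS => i /= /negP; rewrite -ltNge.
have := HA m Am phi true Uphi (fun _ => ltac:(by [])).
by apply: filterS => i /= /negP; rewrite -ltNge.
Qed.

(** Bounds [k] and pairs of rational levels are countable in number, so one countable family of
    large sets serves all continuous functionals. *)
Lemma weak_selector : exists A : nat -> set I, (forall j, U (A j)) /\
  forall m, (forall j, \forall i \near \oo, A j (m i)) ->
  forall (phi : {linear V -> R^o}) (L : R), continuous phi ->
    phi \o z @ U --> L -> phi (z (m i)) @[i --> \oo] --> (L : R^o).
Proof.
pose idx : Type := (nat * (rat * rat))%type.
have ex (d : idx) : exists A : nat -> set I, (forall j, U (A j)) /\
    (ratr d.2.1 < ratr d.2.2 :> R ->
    forall m, (forall j, \forall i \near \oo, A j (m i)) ->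
    forall phi : bounded_functional d.1,
      (U [set n | sval phi (z n) <= ratr d.2.1] ->
        \forall i \near \oo, sval phi (z (m i)) < ratr d.2.2) /\
      (U [set n | ratr d.2.2 <= sval phi (z n)] ->
        \forall i \near \oo, ratr d.2.1 < sval phi (z (m i)))).
  have [/(pair_selector d.1)[A [UA HA]]|nab] :=
    pselect (ratr d.2.1 < ratr d.2.2 :> R); first by exists A.
  by exists (fun=> setT); split=> // j; exact: filterT.
have [B HB] := choice ex.
pose A l := if (unpickle l : option (nat * (rat * rat) * nat)) is Some (d, j)
  then B d j else setT.
exists A; split=> [l|m Am phi L cphi philim].
  by rewrite /A; case: unpickle => [[d j]|]; [have [] := HB d|exact: filterT].
have Bm d j : \forall i \near \oo, B d j (m i).
  have := Am (pickle ((d, j) : nat * (rat * rat) * nat)).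
  by rewrite /A pickleK.
have [k phik] : exists k : nat, forall v, `|phi v| <= k%:R * `|v|.
  have /linear_bounded_continuous/linear_boundedP/pinfty_ex_gt0[r r0 Hr] := cphi.
  exists (Num.bound r) => v; apply: (le_trans (Hr v)); rewrite ler_wpM2r //.
  by rewrite ltW // archi_boundP // ltW.
pose Fi : bounded_functional k := exist _ phi phik.
apply/cvgrPdist_lt => e e0.
(* With [L < p < q < L + e], [phi] is at most [p] on a large set, hence eventually below [q] along
   [m]; similarly for [L - e < s < t < L]. *)
have [p] := rat_in_itvoo (ltac:(by rewrite ltrDl) : L < L + e).
rewrite in_itv /= => /andP[Lp pe].
have [q] := rat_in_itvoo pe; rewrite in_itv /= => /andP[pq qe].
have [s] := rat_in_itvoo (ltac:(by rewrite gtrBl) : L - e < L).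
rewrite in_itv /= => /andP[es sL].
have [t] := rat_in_itvoo sL; rewrite in_itv /= => /andP[st tL].
have up : \forall i \near \oo, phi (z (m i)) < ratr q.
  have [_ /(_ pq m (Bm _) Fi)[+ _]] := HB (k, (p, q)); apply.
  by have /cvgr_le/(_ _ Lp) := philim.
have dn : \forall i \near \oo, ratr s < phi (z (m i)).
  have [_ /(_ st m (Bm _) Fi)[_ +]] := HB (k, (s, t)); apply.
  by have /cvgr_ge/(_ _ tL) := philim.
near=> i; rewrite distrC ltr_distl; apply/andP; split.
  by apply: (lt_trans es); near: i.
by apply: lt_trans qe; near: i.
Unshelve. all: by end_near. Qed.

End l1_free_selection.

(** * Approximate fixed points for finitely many functionals *)

(** Rounding the coordinates to multiples of [d] leaves finitely many classes, and points of one
    class differ by less than [d]. *)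
Lemma finite_net (R : realType) (I : Type) (n : nat) (F : I -> 'I_n -> R) (B d : R) :
  0 < d -> (forall i l, `|F i l| <= B) -> inhabited I ->
  exists (J : finType) (p : J -> I), forall i, exists j,
    forall l, `|F i l - F (p j) l| < d.
Proof.
move=> d0 FB [i0].
have B0 i l : 0 <= (F i l + B) / d.
  rewrite divr_ge0 ?(ltW d0) // -lerBlDr sub0r.
  by have := FB i l; rewrite ler_norml => /andP[].
pose K := Num.trunc ((B + B) / d).
have FK i l : (Num.trunc ((F i l + B) / d) <= K)%N.
  apply: le_truncn; rewrite ler_pM2r ?invr_gt0 // lerD2r.
  exact: le_trans (ler_norm _) (FB i l).
pose color i : {ffun 'I_n -> 'I_K.+1} := [ffun l => inord (Num.trunc ((F i l + B) / d))].
have rep c : exists i, forall i', color i' = c -> color i = c.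
  have [[i Hi]|no] := pselect (exists i, color i = c); first by exists i.
  by exists i0 => i' Hi'; case: no; exists i'.
have [p Hp] := choice rep.
exists {ffun 'I_n -> 'I_K.+1}, p => i; exists (color i) => l.
have /ffunP/(_ l) := Hp _ i erefl; rewrite !ffunE => /(congr1 val).
rewrite /= !inordK ?ltnS // => tr.
have := truncn_itv (B0 i l); have := truncn_itv (B0 (p (color i)) l); rewrite tr.
set k := Num.trunc _; rewrite !ler_pdivlMr // !ltr_pdivrMr // -natr1.
move=> /andP[h1 h2] /andP[h3 h4]; rewrite ltr_norml; apply/andP; split; nra.
Qed.

(** A grid point [s] stands for the [e i] with barycentric weights [s / (N + 1)] and is labelled by
    some [j] near that [i]. The cluster from [scarf_grid] has small weight outside its label set
    [Q], and each label belongs to a point of the cluster, hence one close to [e i]. *)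
Lemma scarf_approx (R : realType) (V : normedModType R) (I : Type) (J : finType)
    (p : J -> V) (e : I -> V) (near : I -> J -> Prop) (M : R) :
  inhabited I -> (forall j, `|p j| <= M) ->
  (forall w : J -> nat, (0 < \sum_j w j)%N ->
     exists i, (\sum_j w j)%:R *: e i = \sum_j (w j)%:R *: p j) ->
  (forall i, exists j, near i j) ->
  forall N, exists i (t : J -> R) (Q : {set J}),
  [/\ forall j, 0 <= t j, \sum_j t j = 1, e i = \sum_j t j *: p j,
      \sum_(j | j \notin Q) t j <= #|J|%:R / N.+1%:R &
      forall j, j \in Q -> exists2 i', near i' j &
        `|e i' - e i| <= #|J|%:R * (#|J|%:R / N.+1%:R * M)].
Proof.
move=> [i0] pM comb near_ex N; have [j0 _] := near_ex i0.
have pick (s : {ffun J -> 'I_N.+2}) : exists ij : I * J, near ij.1 ij.2 /\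
    ((\sum_j s j = N.+1)%N -> N.+1%:R *: e ij.1 = \sum_j (s j)%:R *: p j).
  have [sN|nsN] := pselect (\sum_j s j = N.+1)%N.
    have [|i Hi] := comb (fun j => s j); first by rewrite sN.
    have [j Hj] := near_ex i; exists (i, j); split=> // _.
    by rewrite -Hi sN.
  by have [j Hj] := near_ex i0; exists (i0, j); split.
have [ij Hij] := choice pick.
have [S [/set0Pn[s sS] sumS closeS outS]] := scarf_grid j0 (fun s => (ij s).2).
have N0 : N.+1%:R != 0 :> R by rewrite pnatr_eq0.
have eE s' : s' \in S -> e (ij s').1 = \sum_j ((s' j)%:R / N.+1%:R) *: p j.
  move=> s'S; have [_ /(_ (sumS _ s'S)) es'] := Hij s'.
  apply: (scalerI N0); rewrite es' scaler_sumr.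
  by apply: eq_bigr => j _; rewrite scalerA mulrCA divff // mulr1.
exists (ij s).1, (fun j => (s j)%:R / N.+1%:R), ((fun s => (ij s).2) @: S); split.
- by move=> j; rewrite divr_ge0.
- by rewrite /= -mulr_suml -natr_sum sumS // divff.
- exact: eE.
- rewrite /= -mulr_suml ler_pM2r ?invr_gt0 // -natr_sum ler_nat.
  exact: outS.
move=> _ /imsetP[s' s'S ->]; exists (ij s').1; first by have [] := Hij s'.
rewrite !eE // -sumrB (le_trans (ler_norm_sum _ _ _)) //.
rewrite [leRHS](_ : _ = \sum_(j : J) (#|J|%:R / N.+1%:R * M)); last first.
  by rewrite sumr_const mulr_natl.
apply: ler_sum => j _; rewrite -scalerBl normrZ ler_pM // -mulrBl normrM.
rewrite [X in _ * X]ger0_norm ?invr_ge0 // ler_pM2r ?invr_gt0 //.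
have := closeS s' s j s'S sS; have := closeS s s' j sS s'S.
rewrite -(ler_nat R) natrD => h1; rewrite -(ler_nat R) natrD => h2.
by rewrite ler_norml; apply/andP; split; lra.
Qed.

Section approximate_fixed_point.
Context (R : realType) (V : normedModType R) (D : set V) (f : V -> V).
Hypotheses (clD : closed D) (fcont : {within D, continuous f}).
Context (I : Type) (e : I -> V) (M : R) (i0 : I).
Hypothesis e_D : forall i, D (e i).
Hypothesis e_f : forall i, exists i', e i' = f (e i).
Hypothesis e_bounded : forall i, `|e i| <= M.
Hypothesis e_comb : forall (J : finType) (p : J -> I) (w : J -> nat),
  (0 < \sum_j w j)%N ->
  exists i, (\sum_j w j)%:R *: e i = \sum_j (w j)%:R *: e (p j).

(** A continuous image of a cube. It supplies a cluster point of the approximate points, at which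
    the continuity of [f] is used. *)
Lemma compact_box_image (J : finType) (p : J -> V) :
  compact [set \sum_j t j *: p j | t in [set t : J -> R | forall j, 0 <= t j <= 1]].
Proof.
pose h (v : 'rV[R]_#|J|) : V := \sum_(k < #|J|) v ord0 k *: p (enum_val k).
have hk k : continuous (fun v : 'rV[R]_#|J| => v ord0 k *: p (enum_val k)).
  by move=> v; apply: cvgZr_tmp; [exact: (nbhs_filter v)|exact: coord_continuous].
have hcont : continuous h.
  move=> v; apply: (@cvg_big V _ +%R 0 xpredT _ _ (nbhs v)) => [|k _].
    exact: add_continuous.
  exact: hk.
have cbox : compact [set v : 'rV[R]_#|J| | forall k, `[0, 1]%classic (v ord0 k)].
  by apply: (@rV_compact R _ (fun=> `[0, 1]%classic)) => _; exact: segment_compact.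
have := continuous_compact (continuous_subspaceT hcont) cbox.
congr compact; apply/seteqP; split => [_ [v v01 <-]|_ [t t01 <-]] /=.
  exists (fun j => v ord0 (enum_rank j)).
    by move=> j; have := v01 (enum_rank j); rewrite /= in_itv.
  rewrite /h (reindex (@enum_val J J)) /=; last first.
    by exists enum_rank => k _; rewrite ?enum_valK ?enum_rankK.
  by apply: eq_bigr => k _; rewrite enum_valK.
exists (\row_k t (enum_val k)) => [k|]; first by rewrite /= mxE in_itv /=; apply: t01.
rewrite /h [RHS](reindex (@enum_val J J)) /=; last first.
  by exists enum_rank => k _; rewrite ?enum_valK ?enum_rankK.
by apply: eq_bigr => k _; rewrite mxE.
Qed.

Lemma continuous_linear_bound (phi : {linear V -> R^o}) : continuous phi ->
  exists2 k : R, 0 < k & forall v, `|phi v| <= k * `|v|.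
Proof. by move=> /linear_bounded_continuous/linear_boundedP/pinfty_ex_gt0. Qed.

(** The value of [phi l] at [e i - f (e i)] is the [t]-average of its values at [e (p j) - f (e i)].
    For [j] in [Q], [e (p j)] is close under [phi l] to [f] at a neighbour of [e i], hence to
    [f (e i)] by continuity at the cluster point; the other [j] have little weight. *)
Lemma approximate_fixed_point (n : nat) (phi : 'I_n -> {linear V -> R^o}) (eps : R) :
  (forall l, continuous (phi l)) -> 0 < eps ->
  exists i, forall l, `|phi l (e i - f (e i))| < eps.
Proof.
move=> phic eps0.
have [l|kl Hkl] := @choice 'I_n R
    (fun l k => 0 < k /\ forall v, `|phi l v| <= k * `|v|).
  by have [k] := continuous_linear_bound (phic l); exists k.
pose k := 1 + \sum_l kl l.
have k0 : 0 < k by rewrite ltr_pwDl // sumr_ge0 // => l _; have [/ltW] := Hkl l.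
have phik l v : `|phi l v| <= k * `|v|.
  have [_ /(_ v)/le_trans] := Hkl l; apply; rewrite ler_wpM2r //.
  rewrite /k (bigD1 l) //= addrCA lerDl addr_ge0 // sumr_ge0 // => j _.
  by have [/ltW] := Hkl j.
have M0 : 0 <= M := le_trans (normr_ge0 _) (e_bounded i0).
(* The indices in [Q] will contribute at most [3 * d], made of [d] from the net and [2 * d] from the
   continuity of [f], and the others less than [d]. *)
pose d := eps / 5; have d0 : 0 < d by rewrite divr_gt0.
have phiM l i : `|phi l (e i)| <= k * M.
  by apply: (le_trans (phik l _)); rewrite ler_wpM2l // ltW.
have [J [p netp]] := @finite_net R I n (fun i l => phi l (e i)) (k * M) d d0
  (fun i l => phiM l i) (inhabits i0).
pose close i j := forall l, `|phi l (f (e i)) - phi l (e (p j))| < d.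
have close_ex i : exists j, close i j.
  by have [i' ei'] := e_f i; have [j Hj] := netp i'; exists j => l; rewrite -ei'.
have approx := scarf_approx (inhabits i0) (fun j => e_bounded (p j)) (e_comb p) close_ex.
have [y Hy] := choice approx.
pose K := [set \sum_j t j *: e (p j) | t in [set t : J -> R | forall j, 0 <= t j <= 1]].
have yK N : K (e (y N)).
  have [t [Q [t0 t1 -> _ _]]] := Hy N; exists t => // j /=; rewrite t0 /=.
  by rewrite -t1 (bigD1 j) //= lerDl sumr_ge0.
have [ys [_ ysP]] := @compact_box_image J (fun j => e (p j)) ((e \o y) @ \oo) _
  (filterE _ yK).
have Dys : D ys.
  apply: clD => B nB.
  have [v [Dv Bv]] := ysP D B (filterE _ (fun N => e_D (y N))) nB.
  by exists v.
have : \forall v \near within D (nbhs ys), `|f ys - f v| < d / k.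
  have /subspace_continuousP/(_ ys Dys)/cvgrPdist_lt := fcont; apply.
  by rewrite divr_gt0.
rewrite near_withinE => /nbhs_ballP[r /= r0 Hr].
have frd v : D v -> `|ys - v| < r -> `|f ys - f v| < d / k.
  by move=> Dv yv; apply: Hr => //; rewrite -ball_normE.
have small (a b : R) : 0 <= a -> 0 < b -> \forall N \near \oo, a / N.+1%:R < b.
  move=> a0 b0; have ba : 0 < b / (a + 1) by rewrite divr_gt0 // ltr_wpDl.
  have := near_infty_natSinv_lt (PosNum ba); apply: filterS => N /=.
  rewrite ltr_pdivlMr ?ltr_wpDl // => /(le_lt_trans _); apply.
  by rewrite mulrC ler_wpM2l ?invr_ge0 // lerDl.
(* Divided by [N + 1], [c1] bounds the distance from [e i] to the points of the cluster that bear
   the labels, and [c2] the contribution of the indices outside [Q]. *)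
pose c1 := #|J|%:R * (#|J|%:R * M); pose c2 := 2 * (k * M) * #|J|%:R.
have c10 : 0 <= c1 by rewrite !mulr_ge0.
have c20 : 0 <= c2 by rewrite !mulr_ge0 // ltW.
have r20 : 0 < r / 2 by rewrite divr_gt0.
pose P N := c1 / N.+1%:R < r / 2 /\ c2 / N.+1%:R < d.
have evP : \forall N \near \oo, P N.
  by near=> N; split; near: N; apply: small.
have : ((e \o y) @ \oo) [set v | exists2 N, P N & v = e (y N)].
  by apply: filterS evP => N PN; exists N.
move=> /ysP/(_ (nbhsx_ballx ys _ r20))[_ [[N [PN1 PN2] ->]]].
rewrite -ball_normE /= => yN.
have [t [Q [t0 t1 eE tQ HQ]]] := Hy N.
exists (y N) => l; set i := y N in eE yN HQ *.
have rle : #|J|%:R * (#|J|%:R / N.+1%:R * M) < r / 2.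
  by move: PN1; rewrite /c1 !mulrA mulrAC.
have fd i' : `|ys - e i'| < r -> `|f ys - f (e i')| < d / k.
  by move=> ?; apply: frd.
have fdi : `|f ys - f (e i)| < d / k by apply: fd; lra.
have aQ j : j \in Q -> `|phi l (e (p j)) - phi l (f (e i))| <= 3 * d.
  move=> /HQ[i' ci' ii']; have := ci' l.
  have fdi' : `|f ys - f (e i')| < d / k.
    apply: fd; apply: (le_lt_trans (ler_distD (e i) _ _)).
    by rewrite [ltRHS]splitr ltrD // distrC; apply: le_lt_trans rle.
  have : `|phi l (f (e i')) - phi l (f (e i))| <= 2 * d.
    rewrite -linearB (le_trans (phik _ _)) //.
    rewrite mulrC -ler_pdivlMr // (le_trans (ler_distD (f ys) _ _)) //.
    by rewrite -mulrA mulr_natl mulr2n lerD // ltW // distrC.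
  move=> h1 h2; apply: (le_trans (ler_distD (phi l (f (e i'))) _ _)).
  rewrite (_ : 3 * d = d + 2 * d); last by ring.
  by rewrite lerD // distrC ltW.
have aJ j : `|phi l (e (p j)) - phi l (f (e i))| <= 2 * (k * M).
  have [i'' ei''] := e_f i; rewrite -ei''.
  by rewrite (le_trans (ler_normB _ _)) // mulr_natl mulr2n lerD.
have -> : phi l (e i - f (e i)) =
    \sum_j t j * (phi l (e (p j)) - phi l (f (e i))) :> R.
  rewrite linearB {1}eE linear_sum.
  under [RHS]eq_bigr do rewrite mulrBr.
  rewrite sumrB -mulr_suml t1 mul1r; congr (_ - _).
  by apply: eq_bigr => j _; rewrite linearZ.
rewrite (le_lt_trans (ler_norm_sum _ _ _)) // (bigID [in Q]) /=.
have tQ1 : \sum_(j in Q) t j <= 1.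
  by rewrite -[X in _ <= X]t1 [X in _ <= X](bigID [in Q]) /= lerDl sumr_ge0.
have h1 : \sum_(j in Q) `|t j * (phi l (e (p j)) - phi l (f (e i)))| <= 3 * d.
  apply: (@le_trans _ _ (\sum_(j in Q) t j * (3 * d))).
    by apply: ler_sum => j jQ; rewrite normrM ger0_norm // ler_wpM2l // aQ.
  by rewrite -mulr_suml ler_piMl // mulr_ge0 // ltW.
have h2 : \sum_(j | j \notin Q) `|t j * (phi l (e (p j)) - phi l (f (e i)))| < d.
  apply: le_lt_trans PN2.
  apply: (@le_trans _ _ (\sum_(j | j \notin Q) t j * (2 * (k * M)))).
    by apply: ler_sum => j jQ; rewrite normrM ger0_norm // ler_wpM2l // aJ.
  rewrite -mulr_suml /c2 mulrC -mulrA ler_wpM2l // mulr_ge0 // mulr_ge0 // ltW //.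
by move: h1 h2; rewrite /d; lra.
Unshelve. all: by end_near. Qed.

End approximate_fixed_point.

(** * Spaces without l1-sequences *)

Section countable_invariant_set.
Context (R : realType) (V : normedModType R) (f : V -> V) (x0 : V).

Definition weighted_mean (w : seq nat) (vs : seq V) : V :=
  (\sum_(i < size vs) (nth 0%N w i)%:R)^-1 *:
    \sum_(i < size vs) (nth 0%N w i)%:R *: nth x0 vs i.

(* The values of [tree_eval] form a countable set containing [x0] and closed
   under [f] and rational convex combinations; the label [k.+1] of a node
   encodes the list of weights. *)
Fixpoint tree_eval (t : GenTree.tree unit) : V :=
  match t with
  | GenTree.Leaf _ => x0
  | GenTree.Node 0 ts => if ts is t' :: _ then f (tree_eval t') else x0
  | GenTree.Node k.+1 ts => let w := CodeSeq.decode k in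
      if \sum_(i < size ts) nth 0%N w i == 0%N then x0
      else weighted_mean w (map tree_eval ts)
  end.

Lemma tree_eval_in (D : set V) : convex_set (D : set (convex_lmodType V)) ->
  (forall v, D v -> D (f v)) -> D x0 -> forall t, D (tree_eval t).
Proof.
move=> cD fD Dx0; fix IH 1 => -[u //|[|k] ts].
  by case: ts => [//|t ts] /=; apply: fD; apply: IH.
have Dts i : D (nth x0 (map tree_eval ts) i).
  elim: ts i => [|t ts IHts] [|i] //=; exact: IH.
rewrite /=; case: ifPn => //= w0; rewrite /weighted_mean.
set w := CodeSeq.decode k in w0 *; set vs := map tree_eval ts in Dts *.
have [||||y Dy ->] := @convex_sum _ _ D (nth x0 vs)
  (fun i => (nth 0%N w i)%:R) (size vs) => //.
  by rewrite -natr_sum ltr0n lt0n size_map.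
by rewrite scalerA mulVf ?scale1r // -natr_sum pnatr_eq0 size_map.
Qed.

Lemma tree_eval_node k ts : tree_eval (GenTree.Node k.+1 ts) =
  let w := CodeSeq.decode k in
  if \sum_(i < size ts) nth 0%N w i == 0%N then x0
  else weighted_mean w (map tree_eval ts).
Proof. by []. Qed.

Lemma tree_eval_comb (J : finType) (p : J -> GenTree.tree unit) (w : J -> nat) :
  (0 < \sum_j w j)%N ->
  exists t, (\sum_j w j)%:R *: tree_eval t =
    \sum_j (w j)%:R *: tree_eval (p j).
Proof.
move=> w0; have [j0 _] : exists j0 : J, true.
  case: (pickP (fun _ : J => true)) => [j _|no]; first by exists j.
  by move: w0; rewrite big_pred0.
have [r sumE] : exists r : seq J, forall (M : nmodType) (F : J -> M),
    \sum_j F j = \sum_(i < size r) F (nth j0 r i).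
  exists (enum J) => M F.
  by rewrite -big_enum (big_nth j0) big_mkord.
have nthw (i : 'I_(size r)) : nth 0%N (map w r) i = w (nth j0 r i).
  by rewrite (nth_map j0).
exists (GenTree.Node (CodeSeq.code (map w r)).+1 (map p r)).
rewrite tree_eval_node CodeSeq.codeK /weighted_mean !size_map.
have sumw : (\sum_(i < size r) nth 0 (map w r) i)%N = (\sum_j w j)%N.
  by rewrite (sumE _ w); apply: eq_bigr => i _; rewrite nthw.
rewrite sumw eqn0Ngt w0 -natr_sum sumw scalerA mulfV ?scale1r; last first.
  by rewrite pnatr_eq0 -lt0n.
rewrite [RHS]sumE; apply: eq_bigr => i _.
by rewrite nthw -map_comp (nth_map j0).
Qed.

End countable_invariant_set.

Section weak_null.
Context (R : realType) (V : normedModType R).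

(** The filter generated by the preimages under [g] of the weak neighbourhoods of 0. *)
Definition weak_null_filter (I : Type) (g : I -> V) : set_system I :=
  [set B | exists n (phi : 'I_n -> {linear V -> R^o}) (eps : R),
    [/\ forall l, continuous (phi l), 0 < eps &
        [set i | forall l, `|phi l (g i)| < eps] `<=` B]].

Lemma weak_null_filter_proper (I : Type) (g : I -> V) :
  (forall n (phi : 'I_n -> {linear V -> R^o}) (eps : R),
    (forall l, continuous (phi l)) -> 0 < eps ->
    exists i, forall l, `|phi l (g i)| < eps) ->
  ProperFilter (weak_null_filter g).
Proof.
move=> approx; apply: Build_ProperFilter_ex.
  move=> B [n [phi [eps [phic eps0 sub]]]].
  by have [i Hi] := approx n phi eps phic eps0; exists i; apply: sub.
split.
- have phi0 : 'I_0 -> {linear V -> R^o} by case.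
  by exists 0%N, phi0, 1; split=> // -[].
- move=> A B [n [phi [a [phic a0 subA]]]] [m [psi [b [psic b0 subB]]]].
  exists (n + m)%N, (fun k => match fintype.split k with
    inl l => phi l | inr l => psi l end), (Num.min a b); split.
  + by move=> k; case: fintype.split.
  + by rewrite lt_min a0.
  + move=> i /= Hi; split.
      apply: subA => l; have := Hi (unsplit (inl l)).
      by rewrite unsplitK lt_min => /andP[].
    apply: subB => l; have := Hi (unsplit (inr l)).
    by rewrite unsplitK lt_min => /andP[].
- move=> A B AB [n [phi [a [phic a0 subA]]]]; exists n, phi, a; split=> //.
  exact: subset_trans AB.
Qed.

Theorem no_l1_weak_afpp (C D : set V) :
  bounded_set C ->
  ~ (exists2 x : nat -> V, (forall n, C (x n)) & equivalent_l1_basis x) ->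
  D `<=` C -> D !=set0 -> closed D -> convex_set (D : set (convex_lmodType V)) ->
  weak_afpp D.
Proof.
move=> [M0 [_ bC]] nol1 DC [x0 Dx0] clD cvD f fD fcont.
have CM v : C v -> `|v| <= M0 + 1 by move=> Cv; apply: (bC (M0 + 1)); rewrite ?ltrDl.
pose e := tree_eval f x0; pose fe t := f (e t).
have eD t : D (e t) by exact: tree_eval_in.
have feD t : D (fe t) by exact: fD.
have F_proper : ProperFilter (weak_null_filter (fun t => e t - fe t)).
  apply: weak_null_filter_proper => n phi eps phic eps0.
  apply: (approximate_fixed_point (M := M0 + 1) clD fcont (GenTree.Leaf tt)) => //.
  - by move=> t; exists (GenTree.Node 0 [:: t]).
  - by move=> t; apply/CM/DC.
  - by move=> J p w; apply: tree_eval_comb.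
have [U [UU FU]] := ultraFilterLemma F_proper.
have no_l1 (z : GenTree.tree unit -> V) : (forall t, D (z t)) ->
    forall m : nat -> _, ~ equivalent_l1_basis (z \o m).
  by move=> zD m l1; apply: nol1; exists (z \o m) => // n; apply/DC/zD.
have [A [UA HA]] := weak_selector (U := U) (fun t => CM _ (DC _ (eD t))) (no_l1 _ eD).
have [B [UB HB]] := weak_selector (U := U) (fun t => CM _ (DC _ (feD t))) (no_l1 _ feD).
(* One sequence has to serve both selectors, that of [e] and that of [fe]. *)
have [m Hm] := @countable_diagonal _ U _ (fun j => A j `&` B j)
  (fun j => filterI (UA j) (UB j)).
exists (e \o m) => [n|phi phic]; first exact: eD.
have [k k0 phik] := continuous_linear_bound phic.
have [L philim] : exists L : R, phi \o e @ U --> L.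
  apply: (@ultra_bounded_cvg _ _ U _ _ (k * (M0 + 1))) => t.
  by apply: (le_trans (phik _)); rewrite ler_wpM2l ?(ltW k0) //; apply/CM/DC.
(* As [U] refines the weakly null filter, [phi (e t - fe t)] tends to 0 along [U], so both limits
   agree. *)
have flim : phi \o fe @ U --> L.
  apply/cvgrPdist_lt => eps eps0; have eps20 : 0 < eps / 2 by rewrite divr_gt0.
  have U1 : U [set t | `|phi (e t - fe t)| < eps / 2].
    apply: FU; exists 1%N, (fun=> phi), (eps / 2); split=> // t.
    by move=> /(_ ord0).
  have U2 : U [set t | `|L - phi (e t)| < eps / 2].
    by have /cvgrPdist_lt/(_ _ eps20) := philim.
  apply: filterS (filterI U1 U2) => t /= [h1 h2].
  rewrite (le_lt_trans (ler_distD (phi (e t)) _ _)) //.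
  by rewrite [ltRHS]splitr ltrD // -linearB.
rewrite linear0.
have /HA/(_ phi L phic philim) h1 : forall j, \forall i \near \oo, A j (m i).
  by move=> j; apply: filterS (Hm j) => i [].
have /HB/(_ phi L phic flim) h2 : forall j, \forall i \near \oo, B j (m i).
  by move=> j; apply: filterS (Hm j) => i [].
rewrite -(subrr L).
under eq_cvg do rewrite linearB.
exact: cvgB h1 h2.
Qed.

End weak_null.

Unset Implicit Arguments.

Theorem theorem1p2 (R : realType) (X : completeNormedModType R) (C : set X)
    (C_nonempty : C !=set0) (C_closed : closed C)
    (C_convex : convex_set (C : set (convex_lmodType X)))
    (C_bounded : bounded_set C) :
  (forall D : set X, D `<=` C -> D !=set0 -> closed D ->
     convex_set (D : set (convex_lmodType X)) -> weak_afpp D)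
  <->
  ~ (exists2 x : nat -> X, (forall n, C (x n)) & equivalent_l1_basis x).
Proof.
split=> [afpp|no_l1 D DC Dn0 clD cvD]; last exact: no_l1_weak_afpp no_l1 _ _ _ _.
exact: weak_afpp_no_l1.
Qed.
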